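(* Let $h$ be a real-valued function continuous on $[0,\infty)$ and thrice differentiable on $(0,\infty)$ such that $h(0)=0$, $h(t)\to\infty$ as $t\to\infty$, and for all $t>0$: $h'(t)>0$, $h''(t)<0$, $h'''(t)>0$. Let $Q$ be a cube in $\mathbb{R}^n$. Assume that a function $\varphi\in L^1(Q)$ satisfies $K_{h,Q}(\varphi)<\infty$. Then $\varphi\in\mathrm{BMO}(Q)$ and $$ h^{-1}\big(K_{h,Q}(\varphi)\big)\le\|\varphi\|_{\mathrm{BMO}(Q)}\le 2^{-n/2-1}\,h^{-1}\big(2^{n+2}K_{h,Q}(\varphi)\big), $$ where $h^{-1}$ is the inverse function to $h$ on the interval $[0,\infty)$.
   Context: All cubes have sides parallel to the coordinate axes and finite positive measure; functions are real-valued. For a measurable set $E\subset\mathbb{R}^n$ with $0<|E|<\infty$, $\langle\varphi\rangle_E=\frac1{|E|}\int_E\varphi$. For a non-negative function $h$ on $[0,\infty)$ and $\varphi$ integrable on $Q$, $$K_{h,Q}(\varphi)=\sup_{J}\ \langle h(|\varphi-\langle\varphi\rangle_J|)\rangle_J,$$ the supremum over all subcubes $J$ of $Q$. The norm is $$\|\varphi\|_{\mathrm{BMO}(Q)}=\sup_{J}\big(\langle|\varphi-\langle\varphi\rangle_J|^2\rangle_J\big)^{1/2},$$ the supremum over all subcubes $J$ of $Q$, and $\varphi\in\mathrm{BMO}(Q)$ means $\varphi\in L^1(Q)$ and $\|\varphi\|_{\mathrm{BMO}(Q)}<\infty$. *)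

(* Defs.v *)
From HB Require Import structures.
From mathcomp Require Import all_boot all_order all_algebra.
From mathcomp Require Import all_classical all_reals all_analysis.

Set Implicit Arguments.
Unset Strict Implicit.
Unset Printing Implicit Defensive.

Import Order.TTheory GRing.Theory Num.Theory.
Import numFieldNormedType.Exports.

Local Open Scope classical_set_scope.
Local Open Scope ring_scope.

Section borel_lebesgue_measure.
Context {R : realType}.

Definition cons_pt n (p : measurableTypeR R * n.-tuple (measurableTypeR R)) :
    n.+1.-tuple (measurableTypeR R) :=
  [the n.+1.-tuple (measurableTypeR R) of p.1 :: p.2].

Lemma measurable_cons_pt n : measurable_fun setT (@cons_pt n).
Proof. exact: measurable_cons. Qed.

Section step.
Local Open Scope ereal_scope.
Context (n : nat)
  (m : {sigma_finite_measure set (n.-tuple (measurableTypeR R)) -> \bar R}).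

Definition lebesgue_step : set (n.+1.-tuple (measurableTypeR R)) -> \bar R :=
  pushforward (@lebesgue_measure R \x m) (@cons_pt n).

Let mpre A : measurable A -> measurable (@cons_pt n @^-1` A).
Proof.
by move=> mA; rewrite -[X in measurable X]setTI; exact: measurable_cons_pt.
Qed.

Let step0 : lebesgue_step set0 = 0.
Proof. by rewrite /lebesgue_step /pushforward preimage_set0 measure0. Qed.

Let step_ge0 A : 0 <= lebesgue_step A.
Proof. by rewrite /lebesgue_step /pushforward; apply: measure_ge0. Qed.

Let step_sigma_additive : semi_sigma_additive lebesgue_step.
Proof.
move=> F mF tF mUF; rewrite /lebesgue_step /pushforward preimage_bigcup.
apply: measure_semi_sigma_additive.
- by move=> k; exact: mpre.
- apply/trivIsetP => /= i j _ _ ij; rewrite -preimage_setI.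
  by move/trivIsetP : tF => /(_ _ _ _ _ ij) ->//; rewrite preimage_set0.
- by rewrite -preimage_bigcup; exact: mpre.
Qed.

HB.instance Definition _ := isMeasure.Build _ _ _ lebesgue_step
  step0 step_ge0 step_sigma_additive.

Let step_sigma_finite : sigma_finite setT lebesgue_step.
Proof.
have /sigma_finiteP[F [TF ndF Foo]] := sigma_finiteT (@lebesgue_measure R).
have /sigma_finiteP[G [TG ndG Goo]] := sigma_finiteT m.
pose g (t : n.+1.-tuple (measurableTypeR R)) := (thead t, [tuple of behead t]).
have gK : cancel (@cons_pt n) g.
  by case=> x t; congr pair; apply/val_inj.
have mg : measurable_fun setT g.
  apply: measurable_fun_pair; first exact: measurable_tnth.
  exact: measurable_behead.
exists (fun k => g @^-1` (F k `*` G k)).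
  rewrite -preimage_bigcup -[LHS](preimage_setT g); congr (_ @^-1` _).
  rewrite -setXTT TF TG predeqE => -[x y]; split.
    move=> [/= [k _ Fkx] [l _ Gly]]; exists (maxn k l) => //; split.
    - by move: x Fkx; exact/subsetPset/ndF/leq_maxl.
    - by move: y Gly; exact/subsetPset/ndG/leq_maxr.
  by move=> [k _ []/= ? ?]; split; exists k.
move=> k; have [? ?] := Foo k; have [? ?] := Goo k; split.
  by rewrite -[X in measurable X]setTI; apply: mg => //; exact: measurableX.
rewrite /lebesgue_step /pushforward -comp_preimage.
rewrite (_ : g \o @cons_pt n = id) ?preimage_id.
  by rewrite product_measure1E// lte_mul_pinfty// ge0_fin_numE.
by apply/funext => x /=; exact: gK.
Qed.

HB.instance Definition _ := Measure_isSigmaFinite.Build _ _ _ lebesgue_step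
  step_sigma_finite.

End step.

(* Borel Lebesgue measure on R^n as an n-fold product measure, carried to
   n-tuples by [cons_pt]; see [borel_lebesgue_cube]. *)
Fixpoint borel_lebesgue n :
    {sigma_finite_measure set (n.-tuple (measurableTypeR R)) -> \bar R} :=
  match n with
  | 0 => @dirac _ (0.-tuple (measurableTypeR R)) [tuple] R
  | n'.+1 => lebesgue_step (borel_lebesgue n')
  end.
End borel_lebesgue_measure.

(* The Lebesgue sigma-algebra on R^n is that of the Caratheodory measurable
   sets of the outer measure induced by [borel_lebesgue], as for
   [completed_lebesgue_measure] in dimension 1. *)
Definition lebesgue_space (R : realType) (n : nat) :=
  caratheodory_type (@borel_lebesgue R n)^*%mu.

Definition lebesgue (R : realType) (n : nat) :
    {measure set (lebesgue_space R n) -> \bar R} :=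
  @completed_measure_extension _ _ _ (@borel_lebesgue R n).

Section cubes.
Context {R : realType} {n : nat}.

(* Closed cubes: averages do not see the boundary, so open or half-open cubes
   give the same suprema below. *)
Definition cube (a : n.-tuple R) (l : R) : set (n.-tuple R) :=
  [set x | forall i, tnth a i <= tnth x i <= tnth a i + l].

Definition is_cube (J : set (n.-tuple R)) : Prop :=
  exists (a : n.-tuple R) (l : R), 0 < l /\ J = cube a l.

Definition subcubes (Q : set (n.-tuple R)) : set (set (n.-tuple R)) :=
  [set J | is_cube J /\ J `<=` Q].

Lemma measurable_cube (a : n.-tuple R) (l : R) :
  @measurable _ (n.-tuple (measurableTypeR R)) (cube a l).
Proof.
have -> : cube a l = \bigcap_(i in [set: 'I_n])
    ((fun x : n.-tuple (measurableTypeR R) => tnth x i) @^-1`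
       `[tnth a i, tnth a i + l]%classic).
  apply/seteqP; split => [x ax i _ /=|x ax i].
    by rewrite in_itv/=; exact: ax.
  by have /= := ax i Logic.I; rewrite in_itv.
apply: fin_bigcap_measurable => // i _.
rewrite -[X in measurable X]setTI.
by apply: measurable_tnth => //; exact: measurable_itv.
Qed.

End cubes.

Lemma borel_lebesgue_cube (R : realType) n (a : n.-tuple R) (l : R) :
  0 <= l -> borel_lebesgue n (cube a l) = (l ^+ n)%:E.
Proof.
move=> l0; elim: n a => [|n IH] a.
  rewrite /= diracE (_ : _ \in _ = true) ?expr0//.
  by apply/mem_set; case.
rewrite /= /lebesgue_step /pushforward.
have tla i : tnth a (lift ord0 i) = tnth [tuple of behead a] i.
  by rewrite {1}(tuple_eta a) tnthS.
have -> : @cons_pt R n @^-1` cube a l =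
    `[thead a, thead a + l]%classic `*` cube [tuple of behead a] l.
  apply/seteqP; split => -[x t] /=.
    move=> axt; split; first by rewrite in_itv/=; exact: (axt ord0).
    by move=> i; have := axt (lift ord0 i); rewrite tla tnthS.
  rewrite in_itv/= => -[ax bt] i.
  case: (unliftP ord0 i) => [j|] ->; last exact: ax.
  by have := bt j; rewrite tla tnthS.
rewrite product_measure1E//=; last exact: measurable_cube.
rewrite IH lebesgue_measure_itv/= lte_fin ltrDl.
have [l_gt0|] := ltP 0 l.
  by rewrite -EFinD addrAC subrr add0r -EFinM exprS.
by move=> l_le0; rewrite (_ : l = 0) ?exprS ?mul0r ?mul0e//; apply/le_anti/andP.
Qed.

Lemma lebesgue_cube (R : realType) n (a : n.-tuple R) (l : R) :
  0 <= l -> lebesgue R n (cube a l) = (l ^+ n)%:E.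
Proof.
move=> l0; rewrite -(borel_lebesgue_cube a l0).
have mC := @measurable_cube R n a l.
exact: (measurable_mu_extE (borel_lebesgue n) mC).
Qed.

Section bmo.
Context {R : realType} {n : nat}.
Implicit Types (E J Q : set (n.-tuple R)) (phi f : n.-tuple R -> R).

Definition avg E f : \bar R :=
  ((\int[lebesgue R n]_(x in E) (f x)%:E) / lebesgue R n E)%E.

Definition mean E f : R := fine (avg E f).

(* Functions are total on R^n; only their values on Q matter. *)
Definition L1 Q phi : Prop := (lebesgue R n).-integrable Q (EFin \o phi).

(* The suprema are extended reals: averages of non-negative functions may be
   +oo. *)
Definition K_ (h : R -> R) Q phi : \bar R :=
  ereal_sup [set avg J (fun x => h `|phi x - mean J phi|) | J in subcubes Q].

Definition BMO_norm Q phi : \bar R :=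
  ereal_sup [set sqrte (avg J (fun x => `|phi x - mean J phi| ^+ 2))
            | J in subcubes Q].

Definition BMO Q phi : Prop := L1 Q phi /\ (BMO_norm Q phi < +oo)%E.

End bmo.

(* The inverse of the restriction of h to [0, +oo[; 0 outside its range. *)
Definition inv_on_nonneg {R : realType} (h : R -> R) : R -> R :=
  'pinv_(fun=> 0) `[0, +oo[%classic h.

(* Main.v *)
(* With [g v = h v / v], convex and decreasing because [h''' > 0 > h''], the
   function [|x| g(y/|x|)], continued by affine functions, is a locally convex
   minorant [b] on the parabolic strip [x^2 <= y <= x^2 + (D/2)^2], with
   [b(u, u^2) <= h |u|] and [b(0, y) = h D / D^2 * y].  A dyadic splitting of a
   cube makes N = 2^n pieces; if the variances are at most [E], the convex hull
   of the points (mean, mean square) of the pieces lies in the strip of height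
   [N E].  With [D^2 = 4 N E], induction over the generations bounds
   [h D / D^2 * variance] by the mean of [h |phi_k - mean|] for the dyadic
   averages [phi_k] of [phi].

   This is used twice.  Passing from [phi] to [phi_k] at most doubles the
   h-oscillation, as [h] is subadditive; so the variances of the [phi_k] are
   bounded uniformly in [k], and [phi] is in BMO because [phi_k] tends to [phi]
   in L^1.  Then [k -> oo] with [E] the square of the BMO norm gives the upper
   bound.  The lower bound is Jensen's inequality for the concave function
   [h o sqrt]. *)
Require Import Defs.
From mathcomp Require Import all_boot all_order all_algebra.
From mathcomp Require Import all_classical all_reals all_analysis.
From mathcomp Require Import measurable_realfun ring lra.
Import Order.TTheory GRing.Theory Num.Theory numFieldNormedType.Exports.
Local Open Scope ring_scope.
Local Open Scope classical_set_scope.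

Set Implicit Arguments.
Unset Strict Implicit.
Unset Printing Implicit Defensive.

(** * Gauges *)

(** The obstacle is that the minorant is convex only along segments inside the strip, so the
    induction needs a bound on the variances, while nothing bounds the variance of [phi] beforehand.
    The dyadic averages remove it: the first generation whose variance is too large can be tested
    with [E] equal to that very variance, because all earlier ones are smaller.

    The minorant is linear on the chords from the origin to [(v, v^2)], [v <= D]. The chord with
    [v = D] touches the upper boundary of the strip, at its midpoint of abscissa [D / 2], exactly
    when the height is [(D / 2)^2]; this is the relation [D^2 = 4 N E]. With [E] the squared norm,
    [D] is [2 sqrt N] times the norm and [h D <= 4 N K]; for [N = 2^n] these are the factors
    [2^(-n/2-1)] and [2^(n+2)] of the theorem. The doubling of the oscillation affects only the
    proof that the norm is finite: in the limit of fine generations the extra term vanishes and does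
    not reach the constants. *)

Record gauge (R : realType) (h : R -> R) : Prop := Gauge {
  gauge0 : h 0 = 0;
  gauge_lt : forall s t : R, 0 <= s -> s < t -> h s < h t;
  gauge_tangent : forall s : R, 0 < s ->
    exists2 m : R, 0 <= m & forall t : R, 0 <= t -> h t <= h s + m * (t - s);
  gauge_quad : forall v : R, 0 < v -> exists p s : R,
    [/\ 0 <= p, s <= 0, h v = p * v + s * v ^+ 2 &
        forall w : R, 0 <= w -> p * w + s * w ^+ 2 <= h w];
  gauge_onto : forall y : R, 0 <= y -> exists2 t : R, 0 <= t & h t = y;
  gauge_continuous : continuous (fun t : R => h `|t|) }.

Lemma is_derive_quad (R : realType) (p s x : R) :
  is_derive x 1 (fun y : R => p * y + s * y ^+ 2) (p + s * (x *+ 2)).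
Proof.
have D := is_deriveD (is_deriveZ p (is_derive_id x (1 : R)))
  (is_deriveZ s (is_deriveX 2 (is_derive_id x (1 : R)))).
suff -> : p + s * (x *+ 2) = p *: (1 : R) + s *: ((2%:R * x ^+ 1) *: (1 : R)) by exact: D.
by rewrite /GRing.scale/= !mulr1 expr1 mulr_natl.
Qed.

Section gauge_of_derivatives.
Context {R : realType} (h : R -> R).
Hypothesis h_cont : {within `[0, +oo[%classic, continuous h}.
Hypothesis h_diff1 : forall t : R, 0 < t -> derivable h t 1.
Hypothesis h_diff2 : forall t : R, 0 < t -> derivable h^`() t 1.
Hypothesis h_diff3 : forall t : R, 0 < t -> derivable h^`(2) t 1.
Hypothesis h_0 : h 0 = 0.
Hypothesis h_infty : h t @[t --> +oo] --> +oo.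
Hypothesis h_d1 : forall t : R, 0 < t -> 0 < h^`() t.
Hypothesis h_d2 : forall t : R, 0 < t -> h^`(2) t < 0.
Hypothesis h_d3 : forall t : R, 0 < t -> 0 < h^`(3) t.

Local Notation h1 := (derive1 h).
Local Notation h2 := (derive1n 2 h).
Local Notation h3 := (derive1n 3 h).

(** Subtracting a quadratic lets one mean value theorem serve twice: with [p = s = 0] for
    monotonicity and tangents, in general for the interpolation error of [h_quad]. *)
Let MVT_quad (p s a b : R) : 0 <= a -> a < b -> exists2 c, a < c < b &
  (h b - (p * b + s * b ^+ 2)) - (h a - (p * a + s * a ^+ 2)) =
  (h1 c - (p + s * (c *+ 2))) * (b - a).
Proof.
move=> a0 ab.
have [||c cab E] := @MVT R (h \- (fun x => p * x + s * x ^+ 2))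
    (fun c => h1 c - (p + s * (c *+ 2))) a b ab.
- move=> x; rewrite in_itv/= => /andP[ax xb].
  have x0 : 0 < x by exact: le_lt_trans ax.
  have hx : is_derive x 1 h (h1 x).
    by apply: DeriveDef; [exact: h_diff1|rewrite derive1E].
  exact: (is_deriveB hx (is_derive_quad p s x)).
- apply: within_continuousB.
    apply: continuous_subspaceW h_cont => x /=.
    by rewrite !in_itv/= => /andP[ax _]; rewrite (le_trans a0).
  apply: continuous_subspaceT => x.
  apply: cvgD; first by apply: cvgM; [exact: cvg_cst|exact: cvg_id].
  by apply: cvgM; [exact: cvg_cst|exact: exprn_continuous].
by exists c.
Qed.

Let MVT_h (a b : R) : 0 <= a -> a < b -> exists2 c, a < c < b &
  h b - h a = h1 c * (b - a).
Proof.
move=> a0 ab; have [c cab] := MVT_quad 0 0 a0 ab.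
by rewrite !mul0r !addr0 !subr0; exists c.
Qed.

Let MVT_derive (g : R -> R) (a b : R) : (forall t, 0 < t -> derivable g t 1) ->
  0 < a -> a < b -> exists2 c, a < c < b & g b - g a = (derive1 g) c * (b - a).
Proof.
move=> dg a0 ab; have [||c cab E] := @MVT R g (derive1 g) a b ab.
- move=> x; rewrite in_itv/= => /andP[ax xb].
  by apply: DeriveDef; [apply: dg; exact: lt_trans ax|rewrite derive1E].
- apply: derivable_within_continuous => x; rewrite in_itv/= => /andP[ax xb].
  by apply: dg; exact: lt_le_trans ax.
by exists c.
Qed.

Let h1_decr (a b : R) : 0 < a -> a < b -> h1 b < h1 a.
Proof.
move=> a0 ab; have [c /andP[ac cb] E] := MVT_derive h_diff2 a0 ab.
have c0 : 0 < c by exact: lt_trans ac.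
by rewrite -subr_lt0 E pmulr_llt0 ?subr_gt0//; exact: h_d2.
Qed.

Let h2_incr (a b : R) : 0 < a -> a < b -> h2 a < h2 b.
Proof.
move=> a0 ab; have [c /andP[ac cb] E] := MVT_derive h_diff3 a0 ab.
have c0 : 0 < c by exact: lt_trans ac.
by rewrite -subr_gt0 E mulr_gt0 ?subr_gt0//; exact: h_d3.
Qed.

Let h_lt (s t : R) : 0 <= s -> s < t -> h s < h t.
Proof.
move=> s0 st; have [c /andP[sc ct] E] := MVT_h s0 st.
have := h_d1 (le_lt_trans s0 sc) => hc; rewrite -subr_gt0 E; nra.
Qed.

Let h_tangent (s t : R) : 0 < s -> 0 <= t -> h t <= h s + h1 s * (t - s).
Proof.
move=> s0 t0; have [ts|st|->] := ltgtP t s; last by rewrite subrr mulr0 addr0.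
- have [c /andP[tc cs] E] := MVT_h t0 ts.
  by have := h1_decr (le_lt_trans t0 tc) cs; nra.
- have [c /andP[sc ct] E] := MVT_h (ltW s0) st.
  by have := h1_decr s0 sc; nra.
Qed.

(* The quadratic [p w + s w^2] interpolates [h] at 0, v, v; its error has the
   sign of [h''' * w * (w - v)^2]. *)
Let h_quad (v : R) : 0 < v -> exists p s : R,
    [/\ 0 <= p, s <= 0, h v = p * v + s * v ^+ 2 &
        forall w : R, 0 <= w -> p * w + s * w ^+ 2 <= h w].
Proof.
move=> v0; pose s := (h1 v * v - h v) / v ^+ 2; pose p := h v / v - s * v.
have hv : h v = p * v + s * v ^+ 2 by rewrite /p; field; rewrite gt_eqF.
have h1v : h1 v = p + s * (v *+ 2).
  by rewrite /p /s; field; rewrite gt_eqF.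
(* The tangent at [v], read at 0, gives [h1 v * v <= h v], hence the sign of [s]. *)
have tg0 := h_tangent v0 (lexx 0); rewrite h_0 in tg0.
have s0 : s <= 0.
  rewrite /s ler_pdivrMr ?exprn_gt0// mul0r; nra.
have p0 : 0 <= p.
  have hv0 : 0 <= h v by rewrite -h_0 ltW ?h_lt.
  by rewrite subr_ge0 (@le_trans _ _ 0)// ?divr_ge0 ?(ltW v0)//; nra.
exists p, s; split=> // w.
have f0 : h 0 - (p * 0 + s * 0 ^+ 2) = 0 by rewrite h_0; ring.
have fv : h v - (p * v + s * v ^+ 2) = 0 by rewrite hv subrr.
(* Rolle twice: the error vanishes at 0 and [v], so its derivative vanishes at some [x] in between;
   the derivative also vanishes at [v], so the second derivative vanishes at some [z] between [x]
   and [v]. As [h2] increases, the error rises up to [x], falls to 0 at [v], and rises again. *)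
have [x /andP[x0 xv]] := MVT_quad p s (lexx 0) v0.
rewrite f0 fv !subr0 => /esym/eqP; rewrite mulf_eq0 (gt_eqF v0) orbF subr_eq0.
move=> /eqP fx.
have diff a b : 0 < a -> a < b -> exists2 c, a < c < b &
    (h1 b - (p + s * (b *+ 2))) - (h1 a - (p + s * (a *+ 2))) =
    (h2 c - s *+ 2) * (b - a).
  move=> a0 ab; have [c cab E] := MVT_derive h_diff2 a0 ab; exists c => //.
  by rewrite mulrBl [h2 c]/(derive1 h1 c) -E; ring.
have [z /andP[xz zv]] := diff _ _ x0 xv.
rewrite h1v fx !subrr => /esym/eqP; rewrite mulf_eq0 !subr_eq0 (gt_eqF xv) orbF.
move=> /eqP h2z.
rewrite le_eqVlt => /predU1P[<-|w0]; first by rewrite -subr_ge0 f0.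
rewrite -subr_ge0; have [wx|xw] := ltP w x.
  have [c /andP[c0 cw] E] := MVT_quad p s (lexx 0) w0.
  have [d /andP[cd dx] E'] := diff _ _ c0 (lt_trans cw wx).
  have := h2_incr (lt_trans c0 cd) (lt_trans dx xz).
  move: E; rewrite f0 subr0 subr0 => ->.
  rewrite h2z => h2d; apply: mulr_ge0; last exact: ltW.
  move: E'; rewrite fx subrr sub0r; set F := h1 c - _ => E'.
  rewrite -oppr_le0 E'; apply: mulr_le0_ge0; first by rewrite subr_le0 ltW.
  by rewrite subr_ge0 ltW// (lt_trans cw).
have [wv|vw|->] := ltgtP w v; last by rewrite fv.
  have [c /andP[wc cv] E] := MVT_quad p s (ltW w0) wv.
  have xc := le_lt_trans xw wc.
  have [d /andP[xd dc] E1] := diff _ _ x0 xc.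
  have [e /andP[ce ev] E2] := diff _ _ (lt_trans x0 xc) cv.
  have := h2_incr (lt_trans x0 xd) (lt_trans dc ce).
  move: E E1 E2; rewrite fv sub0r fx h1v !subrr sub0r subr0.
  set F := h1 c - _ => E E1 E2 de.
  (* A positive derivative at [c], between its zeros [x] and [v], would make the second derivative
     positive before [c] and negative after it, although it increases. *)
  have F0 : F <= 0.
    rewrite leNgt; apply/negP => F0.
    have d0 : 0 < h2 d - s *+ 2.
      by rewrite -(pmulr_lgt0 _ (_ : 0 < c - x)) ?subr_gt0// -E1.
    have : 0 < - F.
      rewrite E2 mulr_gt0 ?subr_gt0//; rewrite subr_gt0 in d0.
      exact: lt_trans de.
    by rewrite oppr_gt0 ltNge (ltW F0).
  by rewrite -oppr_le0 E mulr_le0_ge0// subr_ge0 ltW.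
have [c /andP[vc cw] E] := MVT_quad p s (ltW v0) vw.
have [d /andP[vd dc] E'] := diff _ _ v0 vc.
have := h2_incr (lt_trans x0 xz) (lt_trans zv vd).
move: E E'; rewrite fv h1v subrr !subr0 => -> E' h2d.
apply: mulr_ge0; last by rewrite subr_ge0 ltW.
by rewrite E'; apply: mulr_ge0; rewrite subr_ge0 -?h2z ltW.
Qed.

Let h_onto (y : R) : 0 <= y -> exists2 t, 0 <= t & h t = y.
Proof.
move=> y0.
have [b [b0 yb]] : exists b, 0 <= b /\ y <= h b.
  move/cvgryPge : h_infty => /(_ y) H.
  have [b] : exists b, (0 <= b) && (y <= h b).
    have : \forall t \near +oo, (0 <= t) && (y <= h t).
      near=> t; apply/andP; split; first by near: t; exact: nbhs_pinfty_ge.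
      by near: t; exact: H.
    by move/filter_ex.
  by move=> /andP[? ?]; exists b.
have [||c] := @IVT R h 0 b y b0.
- apply: continuous_subspaceW h_cont => x /=.
  by rewrite !in_itv/= => /andP[-> _].
- by rewrite h_0 ge_min le_max y0 yb orbT.
by rewrite in_itv/= => /andP[c0 _] <-; exists c.
Unshelve. all: by end_near. Qed.

Let h_norm_continuous : continuous (fun t : R => h `|t|).
Proof.
have : {within `[0, +oo[%classic, continuous h} by [].
move/continuous_within_itvcyP => [hc h0] t.
have [->|t0] := eqVneq t 0; last first.
  apply: (@continuous_comp R R R (fun t => `|t|) h); first exact: norm_continuous.
  by apply: hc; rewrite in_itv/= andbT normr_gt0.
apply/cvgrPdist_lt => e e0.
have := h0; rewrite normr0 => /cvgrPdist_lt/(_ e e0) => -[d/= d0 H].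
near=> x; have [->|x0] := eqVneq x 0; first by rewrite normr0 subrr normr0.
apply: H; last by rewrite normr_gt0.
rewrite /= sub0r normrN normr_id.
by near: x; exact: (@cvgr0_norm_lt _ _ _ _ _ id).
Unshelve. all: by end_near. Qed.

(** From here on [h] is used only through these facts and no longer through its derivatives. The
    sign of [h'''] enters through the supporting quadratics alone. *)
Lemma gauge_of_derivatives : gauge h.
Proof.
split=> //.
move=> s s0; exists (h1 s); first by rewrite ltW ?h_d1.
by move=> t t0; exact: h_tangent.
Qed.

End gauge_of_derivatives.

Lemma inv_on_nonnegK (R : realType) (h : R -> R) : gauge h ->
  forall t : R, 0 <= t -> inv_on_nonneg h (h t) = t.
Proof.
move=> gh t t0; apply: pinvKV; last by rewrite inE/= in_itv/= t0.
move=> x y; rewrite !inE/= !in_itv/= !andbT => x0 y0 hxy.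
by have [/(gauge_lt gh x0)|/(gauge_lt gh y0)|//] := ltgtP x y; rewrite hxy ltxx.
Qed.

(** * The minorant *)

Section bellman.
Context {R : realType}.
Variables (h p s : R -> R) (D : R).
Hypothesis D0 : 0 < D.
Hypothesis h_0 : h 0 = 0.
Hypothesis h_ge0 : forall t, 0 <= t -> 0 <= h t.
Hypothesis p0 : forall v, 0 < v -> 0 <= p v.
Hypothesis s0 : forall v, 0 < v -> s v <= 0.
Hypothesis hE : forall v, 0 < v -> h v = p v * v + s v * v ^+ 2.
Hypothesis hge : forall v w, 0 < v -> 0 <= w -> p v * w + s v * w ^+ 2 <= h w.

Let k := h D / D ^+ 2.

(** The first case is [(|x| / v) * h v] with [v = y / |x|]; at the origin, division by zero makes it
    0. On [|x| = D / 2] the strip satisfies [y <= D * |x|], so inside it the other two regions touch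
    only at the points of tangency and the jump between them lies outside. *)
Definition bellman (x y : R) : R :=
  if y <= D * `|x| then x ^+ 2 / y * h (y / `|x|)
  else if `|x| < D / 2 then k * y
  else p D * `|x| + s D * y.

(** The quadratics of [v] and of [D] lie below [h] and touch it at their own points. Comparing them
    at both points and adding gives [(s D - s v) * (D - v) >= 0]. *)
Let supp_incr v : 0 < v -> v <= D -> s v <= s D.
Proof.
move=> v0; rewrite le_eqVlt => /predU1P[->//|vD].
have e1 : p D * v + s D * v ^+ 2 <= p v * v + s v * v ^+ 2.
  by rewrite -hE// hge// ltW.
have e2 : p v * D + s v * D ^+ 2 <= p D * D + s D * D ^+ 2.
  by rewrite -hE// hge// ltW.
have f1 : p D + s D * v <= p v + s v * v.
  by rewrite -(ler_pM2r v0) !mulrDl -!mulrA -!expr2.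
have f2 : p v + s v * D <= p D + s D * D.
  by rewrite -(ler_pM2r D0) !mulrDl -!mulrA -!expr2.
rewrite -subr_ge0 -(pmulr_lge0 _ (_ : 0 < D - v)) ?subr_gt0//.
by lra.
Qed.

(** As [k = p D / D + s D], the quadratic of [D] exceeds [k v^2] by [p D * v * (1 - v / D)]. *)
Let ksqr_le v : 0 <= v -> v <= D -> k * v ^+ 2 <= h v.
Proof.
rewrite le_eqVlt => /predU1P[<- _|v0 vD]; first by rewrite expr0n mulr0 h_0.
have sD : h D / D = p D + s D * D by rewrite hE//; field; rewrite gt_eqF.
have := hge D0 (ltW v0); apply: le_trans.
have -> : k * v ^+ 2 = (h D / D) * (v / D) * v.
  by rewrite /k; field; rewrite gt_eqF.
have -> : p D * v + s D * v ^+ 2 = (p D + s D * v) * v by ring.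
rewrite ler_pM2r// sD mulrA ler_pdivrMr//.
have := p0 D0; have := s0 D0; nra.
Qed.

(** These planes support [bellman]: the plane of [v] is attained on the chord [y = v |x|], and the
    plane of [D] also in the right region. They give Jensen's inequality at every barycentre outside
    the central region. *)
Let plane_le_bellman v (x y : R) : 0 < v -> v <= D -> x ^+ 2 <= y ->
  p v * `|x| + s v * y <= bellman x y.
Proof.
move=> v0 vD xy; have y0 : 0 <= y by rewrite (le_trans _ xy)// sqr_ge0.
have pD : p v * D + s v * D ^+ 2 <= h D by rewrite hge// ltW.
have pD' : p v + s v * D <= h D / D.
  by rewrite ler_pdivlMr// mulrDl -mulrA -expr2.
rewrite /bellman; have [yx|yx] := leP y (D * `|x|).
  have [x0|x0] := eqVneq x 0.
    have -> : y = 0 by apply/le_anti; rewrite y0 (le_trans yx)// x0 normr0 mulr0.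
    by rewrite x0 normr0 expr0n !mulr0 !mul0r addr0.
  have nx0 : 0 < `|x| by rewrite normr_gt0.
  have {}y0 : 0 < y by rewrite (lt_le_trans _ xy)// exprn_even_gt0.
  have := hge v0 (ltW (divr_gt0 y0 nx0)).
  rewrite -(ler_pM2l (_ : 0 < x ^+ 2 / y)); last first.
    by rewrite divr_gt0// exprn_even_gt0.
  apply: le_trans; rewrite -(real_normK (num_real x)) le_eqVlt.
  by apply/orP; left; apply/eqP; field; rewrite !gt_eqF.
have [xD|xD] := ltP `|x| (D / 2).
  have -> : k = h D / D / D by rewrite /k; field; rewrite gt_eqF.
  apply: (@le_trans _ _ (h D / D * `|x|)).
    apply: (@le_trans _ _ ((p v + s v * D) * `|x|)); last by rewrite ler_wpM2r.
    by rewrite mulrDl lerD2l -mulrA ler_wnM2l ?s0// ltW.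
  rewrite -[leRHS]mulrA ler_wpM2l//; last by rewrite ler_pdivlMl// ltW.
  by rewrite divr_ge0 ?h_ge0// ltW.
have sD := supp_incr v0 vD.
have hD : h D / D = p D + s D * D by rewrite hE//; field; rewrite gt_eqF.
rewrite hD in pD'.
have := ler_wpM2l (normr_ge0 x) pD'.
have := ler_wpM2r (_ : 0 <= y - D * `|x|) sD; rewrite subr_ge0 ltW// => /(_ isT).
lra.
Qed.

(** The support for central barycentres. It may fail in the right region, where [k y] exceeds the
    plane of [D] by [p D * (y / D - |x|)]; hence the second hypothesis. *)
Let central_le_bellman (x y : R) : x ^+ 2 <= y ->
  (D * `|x| < y -> `|x| < D / 2) -> k * y <= bellman x y.
Proof.
move=> xy xD; have y0 : 0 <= y by rewrite (le_trans _ xy)// sqr_ge0.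
rewrite /bellman; have [yx|yx] := leP y (D * `|x|); last by rewrite xD.
have [x0|x0] := eqVneq x 0.
  have -> : y = 0 by apply/le_anti; rewrite y0 (le_trans yx)// x0 normr0 mulr0.
  by rewrite x0 expr0n !mulr0 !mul0r.
have nx0 : 0 < `|x| by rewrite normr_gt0.
have {}y0 : 0 < y by rewrite (lt_le_trans _ xy)// exprn_even_gt0.
have := ksqr_le (ltW (divr_gt0 y0 nx0)); rewrite ler_pdivrMr// => /(_ yx).
rewrite -(ler_pM2l (_ : 0 < x ^+ 2 / y)); last first.
  by rewrite divr_gt0// exprn_even_gt0.
apply: le_trans; rewrite -(real_normK (num_real x)) le_eqVlt.
by apply/orP; left; apply/eqP; field; rewrite !gt_eqF.
Qed.

Lemma bellman_sqr (u : R) : bellman u (u ^+ 2) <= h `|u|.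
Proof.
rewrite /bellman -(real_normK (num_real u)); set t := `|u|.
have t0 : 0 <= t by exact: normr_ge0.
have [->|tn0] := eqVneq t 0; first by rewrite expr0n mulr0 lexx !mul0r h_0.
have {}t0 : 0 < t by rewrite lt_def tn0.
rewrite expr2 ler_pM2r//; have [_|Dt] := leP t D.
  by rewrite divff ?mul1r ?mulfK// mulf_neq0.
have [tD|_] := ltP t (D / 2); last by rewrite -expr2 hge// ltW.
by have := D0; lra.
Qed.

Lemma bellman0 (y : R) : 0 <= y -> bellman 0 y = k * y.
Proof.
rewrite /bellman normr0 mulr0 divr_gt0// => y0.
have [y0'|//] := leP y 0; have -> : y = 0 by apply/le_anti/andP.
by rewrite expr0n !mul0r mulr0.
Qed.

(* If a segment joins the central region to the region right of the tangent
   point, it leaves the parabolic strip at the abscissa [d]. *)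
Let strip_convex (d mu nu x y : R) : mu < d -> d <= x ->
  nu - mu ^+ 2 <= d ^+ 2 -> y - 2 * mu * x + mu ^+ 2 <= d ^+ 2 ->
  2 * d * mu < nu -> 2 * d * x < y -> False.
Proof.
move=> mud dx V E numu yx.
have d1 : 0 < d - mu by rewrite subr_gt0.
have d2 : 0 <= x - d by rewrite subr_ge0.
have := ler_wpM2l d2 V; have := ler_wpM2l (ltW d1) E.
have := ler_wpM2l d2 (ltW numu).
rewrite -(ltr_pM2l d1) in yx.
have : 0 <= (x - mu) * (d - mu) ^+ 2 by rewrite mulr_ge0 ?sqr_ge0//; lra.
lra.
Qed.

(** One affine function suffices: it must be attained at the barycentre and lie below [bellman] at
    each of the points [(X i, Y i)]. *)
Lemma bellman_jensen (I : finType) (X Y : I -> R)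
    (mu := (\sum_i X i) / #|I|%:R) (nu := (\sum_i Y i) / #|I|%:R) :
  (0 < #|I|)%N -> (forall i, X i ^+ 2 <= Y i) ->
  #|I|%:R * (nu - mu ^+ 2) <= (D / 2) ^+ 2 ->
  bellman mu nu <= (\sum_i bellman (X i) (Y i)) / #|I|%:R.
Proof.
move=> I0 XY var.
have N0 : 0 < #|I|%:R :> R by rewrite ltr0n.
have affine a b : (forall i, a * X i + b * Y i <= bellman (X i) (Y i)) ->
    a * mu + b * nu <= (\sum_i bellman (X i) (Y i)) / #|I|%:R.
  move=> H; rewrite !mulrA -mulrDl ler_pM2r ?invr_gt0// !mulr_sumr -big_split/=.
  exact: ler_sum.
(* The planes contain [|x|]. Replacing it by [e * x] with [e] the sign of [mu] makes them linear,
   and [p v >= 0] keeps them below. *)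
have plane v (e : R) : 0 < v -> v <= D -> `|e| <= 1 ->
    p v * (e * mu) + s v * nu <= (\sum_i bellman (X i) (Y i)) / #|I|%:R.
  move=> v0 vD e1; rewrite mulrA; apply: affine => i.
  apply: le_trans (plane_le_bellman v0 vD (XY i)).
  rewrite lerD2r -mulrA ler_wpM2l ?p0// (le_trans (ler_norm _))// normrM.
  by rewrite ler_piMl.
have sg1 : `|Num.sg mu| <= 1 by rewrite normr_sg; case: (mu != 0).
(* Each term is [(Y j - X j ^+ 2) + (X j - mu) ^+ 2 >= 0], so a single one is at most their sum.
   Here the factor [N] is lost. *)
have E i : Y i - 2 * mu * X i + mu ^+ 2 <= (D / 2) ^+ 2.
  apply: le_trans var.
  have -> : #|I|%:R * (nu - mu ^+ 2) = \sum_j (Y j - 2 * mu * X j + mu ^+ 2).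
    rewrite big_split/= sumrB sumr_const -mulr_sumr -mulr_natr.
    have -> : \sum_j X j = #|I|%:R * mu by rewrite mulrC divfK// gt_eqF.
    have -> : \sum_j Y j = #|I|%:R * nu by rewrite mulrC divfK// gt_eqF.
    by ring.
  rewrite (bigD1 i)//= lerDl sumr_ge0// => j _.
  by have := XY j; have := sqr_ge0 (X j - mu); lra.
have munu : mu ^+ 2 <= nu.
  rewrite -subr_ge0 -(pmulr_rge0 _ N0).
  have -> : #|I|%:R * (nu - mu ^+ 2) = \sum_j (Y j - 2 * mu * X j + mu ^+ 2).
    rewrite big_split/= sumrB sumr_const -mulr_sumr -mulr_natr.
    have -> : \sum_j X j = #|I|%:R * mu by rewrite mulrC divfK// gt_eqF.
    have -> : \sum_j Y j = #|I|%:R * nu by rewrite mulrC divfK// gt_eqF.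
    by ring.
  rewrite sumr_ge0// => j _.
  by have := XY j; have := sqr_ge0 (X j - mu); lra.
have V : nu - mu ^+ 2 <= (D / 2) ^+ 2.
  apply: le_trans var; rewrite ler_peMl ?subr_ge0// ler1n//.
rewrite {1}/bellman; have [mD|mD] := leP nu (D * `|mu|).
  have [m0|m0] := eqVneq mu 0.
    have := plane D 0 D0 (lexx D); rewrite normr0 ler01 => /(_ isT).
    have -> : nu = 0.
      by apply/le_anti; rewrite (le_trans mD) ?m0 ?normr0 ?mulr0//= (le_trans _ munu)// sqr_ge0.
    by rewrite m0 expr0n !mul0r !mulr0 addr0.
  have nm0 : 0 < `|mu| by rewrite normr_gt0.
  have n0 : 0 < nu by rewrite (lt_le_trans _ munu)// exprn_even_gt0.
  have v0 := divr_gt0 n0 nm0.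
  have vD : nu / `|mu| <= D by rewrite ler_pdivrMr.
  have := plane _ (Num.sg mu) v0 vD sg1; rewrite -normrEsg; apply: le_trans.
  rewrite (hE v0) -(real_normK (num_real mu)) le_eqVlt.
  by apply/orP; left; apply/eqP; field; rewrite !gt_eqF.
have [mD2|mD2] := ltP `|mu| (D / 2); last first.
  by have := plane D (Num.sg mu) D0 (lexx D) sg1; rewrite -normrEsg.
(* At a central barycentre the support is [k y]. It can fail only at a point of the right region,
   whose segment to the barycentre would leave the strip. *)
have := affine 0 k; rewrite mul0r add0r; apply=> i; rewrite mul0r add0r.
apply: central_le_bellman => // YX; rewrite ltNge; apply/negP => XD.
have dE : 2 * (D / 2) = D by field.
have [Mm mM] : mu <= `|mu| /\ - mu <= `|mu|.
  by split; rewrite ?ler_norm// -normrN ler_norm.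
have [X0|X0] := leP 0 (X i).
  move: XD YX; rewrite (ger0_norm X0) => XD YX.
  apply: (@strip_convex (D / 2) mu nu (X i) (Y i)) => //.
  - exact: le_lt_trans mD2.
  - by rewrite dE; apply: le_lt_trans mD; rewrite ler_wpM2l// ltW.
  - by rewrite dE.
(* The mirror image of the previous case: both abscissae change sign. *)
move: XD YX; rewrite (ltr0_norm X0) => XD YX.
apply: (@strip_convex (D / 2) (- mu) nu (- X i) (Y i)) => //.
- exact: le_lt_trans mD2.
- by rewrite sqrrN.
- by rewrite sqrrN mulrN mulrN mulNr opprK; exact: E.
- by rewrite dE; apply: le_lt_trans mD; rewrite ler_wpM2l// ltW.
- by rewrite dE.
Qed.
End bellman.

(** * Averages over trees *)

Section tree_average.
Context {R : realType} {C : Type} {I : finType}.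
Variable child : C -> I -> C.
Hypothesis I0 : (0 < #|I|)%N.
Implicit Types (F G M : C -> R) (c : C).

Let N : R := #|I|%:R.

Let N0 : 0 < N. Proof. by rewrite ltr0n. Qed.

Fixpoint tree_avg (k : nat) F c : R :=
  if k is k'.+1 then (\sum_i tree_avg k' F (child c i)) / N else F c.

Lemma tree_avgD k F G c :
  tree_avg k (fun x => F x + G x) c = tree_avg k F c + tree_avg k G c.
Proof.
elim: k c => //= k IH c; rewrite -mulrDl -big_split/=.
by under eq_bigr do rewrite IH.
Qed.

Lemma tree_avgZ k a F c : tree_avg k (fun x => a * F x) c = a * tree_avg k F c.
Proof.
elim: k c => //= k IH c; rewrite mulrA mulr_sumr.
by under eq_bigr do rewrite IH.
Qed.

Lemma tree_avg_cst k a c : tree_avg k (fun=> a) c = a.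
Proof.
elim: k c => //= k IH c; under eq_bigr do rewrite IH.
by rewrite sumr_const -mulr_natr mulfK// gt_eqF.
Qed.

Lemma tree_avg_geometric k a F c : (forall x i, F (child x i) = a * F x) ->
  tree_avg k F c = a ^+ k * F c.
Proof.
move=> FE; elim: k c => /= [|k IH] c; first by rewrite expr0 mul1r.
under eq_bigr do rewrite IH FE.
by rewrite sumr_const -mulr_natr mulfK ?gt_eqF// mulrA -exprSr.
Qed.

Lemma tree_avgB k F G c :
  tree_avg k (fun x => F x - G x) c = tree_avg k F c - tree_avg k G c.
Proof.
under [in LHS]eq_fun do rewrite -mulN1r.
by rewrite tree_avgD tree_avgZ mulN1r.
Qed.

Definition tree_var k M c : R :=
  tree_avg k (fun x => M x ^+ 2) c - (tree_avg k M c) ^+ 2.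

Lemma tree_avg_sqrB k M a c :
  tree_avg k (fun x => (M x - a) ^+ 2) c =
  tree_var k M c + (tree_avg k M c - a) ^+ 2.
Proof.
rewrite /tree_var.
have -> : (fun x => (M x - a) ^+ 2) =
    (fun x => M x ^+ 2 - (2 * a) * M x + a ^+ 2) by apply/funext => x; ring.
by rewrite tree_avgD tree_avgB tree_avgZ tree_avg_cst; ring.
Qed.

Section invariant.
Variable P : C -> Prop.
Hypothesis Pchild : forall c i, P c -> P (child c i).

(** The comparison is required only under an inherited property [P], such as integrability on the
    cell or inclusion in [Q]. *)
Lemma tree_avg_le k F G c : (forall x, P x -> F x <= G x) -> P c ->
  tree_avg k F c <= tree_avg k G c.
Proof.
move=> FG; elim: k c => [|k IH] c Pc /=; first exact: FG.
by rewrite ler_pM2r ?invr_gt0//; apply: ler_sum => i _; apply: IH; apply: Pchild.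
Qed.

Lemma tree_avg_ge0 k F c : (forall x, P x -> 0 <= F x) -> P c ->
  0 <= tree_avg k F c.
Proof. by move=> F0 Pc; rewrite -(tree_avg_cst k 0 c); exact: tree_avg_le. Qed.

Lemma tree_avg_harmonic k F c :
  (forall x, P x -> F x = (\sum_i F (child x i)) / N) -> P c ->
  tree_avg k F c = F c.
Proof.
move=> HF; elim: k c => //= k IH c Pc; rewrite [RHS]HF//.
by congr (_ / N); apply: eq_bigr => i _; apply: IH; exact: Pchild.
Qed.
End invariant.

Lemma tree_avg_sqr_ge k M c : tree_avg k M c ^+ 2 <= tree_avg k (fun x => M x ^+ 2) c.
Proof.
have := @tree_avg_ge0 (fun=> True) (fun _ _ _ => Logic.I) k
  (fun x => (M x - tree_avg k M c) ^+ 2) c (fun _ _ => sqr_ge0 _) Logic.I.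
by rewrite tree_avg_sqrB subrr expr0n addr0 subr_ge0.
Qed.

Lemma tree_var_ge0 k M c : 0 <= tree_var k M c.
Proof. by rewrite subr_ge0 tree_avg_sqr_ge. Qed.

Lemma tree_varB k M a c : tree_var k (fun x => M x - a) c = tree_var k M c.
Proof.
by rewrite {1}/tree_var tree_avg_sqrB tree_avgB tree_avg_cst addrK.
Qed.

Section gauge_bound.
Variable (h : R -> R).
Hypothesis gh : gauge h.

Variables (P : C -> Prop) (M : C -> R) (k : nat) (E D : R).
Hypothesis Pchild : forall c i, P c -> P (child c i).
Hypothesis D0 : 0 < D.
Hypothesis ED : 4 * N * E <= D ^+ 2.
Hypothesis var_le : forall j c, (j < k)%N -> P c -> tree_var j M c <= E.

(** In generation [k] the bound [E] is asked at [c] alone. This allows [tree_var_bounded] to take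
    for [E] the variance under examination. *)
Lemma tree_var_gauge c : P c -> tree_var k M c <= E ->
  h D / D ^+ 2 * tree_var k M c <=
  tree_avg k (fun x => h `|M x - tree_avg k M c|) c.
Proof.
(* Centring puts the root at abscissa 0 with the variance as ordinate, where [bellman] is
   [h D / D ^+ 2] times the ordinate. *)
move=> Pc Ec; set m := tree_avg k M c; pose M' x := M x - m.
have [p pP] : {p : R -> R & forall v, 0 < v -> exists s : R,
    [/\ 0 <= p v, s <= 0, h v = p v * v + s * v ^+ 2 &
        forall w : R, 0 <= w -> p v * w + s * w ^+ 2 <= h w]}.
  apply: (@choice _ _ (fun v q => 0 < v -> exists s : R,
    [/\ 0 <= q, s <= 0, h v = q * v + s * v ^+ 2 &
        forall w : R, 0 <= w -> q * w + s * w ^+ 2 <= h w])) => v.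
  have [v0|v0] := ltP 0 v; last by exists 0.
  by have [q [s H]] := gauge_quad gh v0; exists q => _; exists s.
have [s sP] : {s : R -> R & forall v, 0 < v ->
    [/\ 0 <= p v, s v <= 0, h v = p v * v + s v * v ^+ 2 &
        forall w : R, 0 <= w -> p v * w + s v * w ^+ 2 <= h w]}.
  apply: (@choice _ _ (fun v s => 0 < v ->
    [/\ 0 <= p v, s <= 0, h v = p v * v + s * v ^+ 2 &
        forall w : R, 0 <= w -> p v * w + s * w ^+ 2 <= h w])) => v.
  have [v0|v0] := ltP 0 v; last by exists 0.
  by have [s H] := pP v v0; exists s.
have h_ge0 t : 0 <= t -> 0 <= h t.
  rewrite le_eqVlt => /predU1P[<-|t0]; first by rewrite (gauge0 gh).
  by rewrite -(gauge0 gh) ltW// (gauge_lt gh).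
pose b := bellman h p s D.
have sp v : 0 < v -> 0 <= p v by case/sP => ? ? ? ?.
have ss v : 0 < v -> s v <= 0 by case/sP => ? ? ? ?.
have sE v : 0 < v -> h v = p v * v + s v * v ^+ 2 by case/sP => ? ? ? ?.
have sg v w : 0 < v -> 0 <= w -> p v * w + s v * w ^+ 2 <= h w.
  by move=> /sP[_ _ _]; exact.
have key j x : (j <= k)%N -> P x -> tree_var j M x <= E ->
    b (tree_avg j M' x) (tree_avg j (fun x => M' x ^+ 2) x) <=
    tree_avg j (fun x => h `|M' x|) x.
  elim: j x => [|j IH] x jk Px Ex /=; first by apply: bellman_sqr => //; exact: (gauge0 gh).
  apply: (@le_trans _ _ ((\sum_i b (tree_avg j M' (child x i))
      (tree_avg j (fun x => M' x ^+ 2) (child x i))) / N)).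
    apply: bellman_jensen => //; first exact: (gauge0 gh).
      by move=> i; exact: tree_avg_sqr_ge.
    rewrite -[_ - _]/(tree_var j.+1 M' x) tree_varB.
    have := Ex; rewrite -(ler_pM2l N0) => /le_trans; apply.
    by have := ED; rewrite -/N; lra.
  rewrite ler_pM2r ?invr_gt0//; apply: ler_sum => i _.
  by apply: IH; [exact: ltnW|exact: Pchild|apply: var_le => //; exact: Pchild].
have := key k c (leqnn k) Pc Ec.
have -> : tree_avg k M' c = 0 by rewrite tree_avgB tree_avg_cst subrr.
rewrite tree_avg_sqrB subrr expr0n addr0 /b bellman0//.
exact: tree_var_ge0.
Qed.
End gauge_bound.
End tree_average.

(** * Averages over a tree of cells *)

Section gauge_theory.
Context {R : realType} (h : R -> R).
Hypothesis gh : gauge h.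

Lemma gauge_le (s t : R) : 0 <= s -> s <= t -> h s <= h t.
Proof.
by move=> s0; rewrite le_eqVlt => /predU1P[->//|/(gauge_lt gh s0)/ltW].
Qed.

Lemma gauge_ge0 (t : R) : 0 <= t -> 0 <= h t.
Proof. by move=> t0; rewrite -(gauge0 gh); exact: gauge_le. Qed.

Let gauge_ratio (s t : R) : 0 < s -> s <= t -> h t / t <= h s / s.
Proof.
move=> s0 st; have t0 : 0 < t by exact: lt_le_trans st.
have [M M0 HM] := gauge_tangent gh s0.
have H0 := HM 0 (lexx 0); have Ht := HM t (ltW t0).
rewrite (gauge0 gh) in H0.
rewrite ler_pdivrMr// mulrAC ler_pdivlMr//.
have := ler_wpM2l (_ : 0 <= t - s) H0; rewrite subr_ge0 => /(_ st).
have := ler_wpM2r (ltW s0) Ht.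
lra.
Qed.

(** As [h t / t] does not increase, the slope at [s + t] is at most those at [s] and [t]; weight it
    by [s] and by [t] and add. *)
Lemma gauge_subadditive (s t : R) : 0 <= s -> 0 <= t -> h (s + t) <= h s + h t.
Proof.
rewrite le_eqVlt => /predU1P[<-|s0]; first by rewrite add0r (gauge0 gh) add0r.
rewrite le_eqVlt => /predU1P[<-|t0]; first by rewrite addr0 (gauge0 gh) addr0.
have st0 : 0 < s + t by rewrite addr_gt0.
have := gauge_ratio s0 (_ : s <= s + t); rewrite lerDl (ltW t0) => /(_ isT).
have := gauge_ratio t0 (_ : t <= s + t); rewrite lerDr (ltW s0) => /(_ isT).
rewrite ler_pdivlMr// ler_pdivlMr// => H1 H2.
have := lerD H2 H1.
have -> : h (s + t) / (s + t) * s + h (s + t) / (s + t) * t = h (s + t).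
  by field; rewrite gt_eqF.
by [].
Qed.

End gauge_theory.

(** Isolates what the averaging arguments need from the geometry: each cell splits into [#|I|]
    children of equal measure, so that cell averages are plain means of those of the children. *)
Record cell_tree (d : measure_display) (T : measurableType d) (R : realType)
    (mu : {measure set T -> \bar R}) (C : Type) (I : finType)
    (child : C -> I -> C) (cell : C -> set T) : Prop := CellTree {
  cell_index_gt0 : (0 < #|I|)%N;
  cell_measurable : forall c, measurable (cell c);
  cell_mu_lty : forall c, (mu (cell c) < +oo)%E;
  cell_mu_gt0 : forall c, (0 < mu (cell c))%E;
  cell_bigcup : forall c, cell c = \bigcup_i cell (child c i);
  cell_trivIset : forall c, trivIset setT (fun i => cell (child c i));
  cell_mu_child : forall c i,
    fine (mu (cell c)) = #|I|%:R * fine (mu (cell (child c i))) }.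

Section cell_averages.
Context {d : measure_display} {T : measurableType d} {R : realType}.
Context {mu : {measure set T -> \bar R}} {C : Type} {I : finType}.
Context {child : C -> I -> C} {cell : C -> set T}.
Hypothesis tree : cell_tree mu child cell.

Let I0 := cell_index_gt0 tree.
Let measurable_cell := cell_measurable tree.
Let mu_cell_fin := cell_mu_lty tree.
Let mu_cell_gt0 := cell_mu_gt0 tree.
Let cell_child := cell_bigcup tree.
Let trivIset_child := cell_trivIset tree.
Let mu_child := cell_mu_child tree.

Implicit Types (c : C) (f g : T -> R).

Local Notation tavg := (tree_avg child).
Local Notation int c f := (mu.-integrable (cell c) (EFin \o f)).

Let vol c : R := fine (mu (cell c)).

Let vol_gt0 c : 0 < vol c.
Proof. by rewrite fine_gt0// mu_cell_gt0 mu_cell_fin. Qed.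

(* Locked, to keep unification from unfolding the integral. *)
Fact cell_avg_key : unit. Proof. by []. Qed.
Definition cell_avg c f : R :=
  locked_with cell_avg_key ((\int[mu]_(x in cell c) f x) / vol c).

Lemma cell_avgE c f : cell_avg c f = (\int[mu]_(x in cell c) f x) / vol c.
Proof. by rewrite /cell_avg unlock. Qed.

Local Notation av := cell_avg.

Lemma sub_cell_child c i : cell (child c i) `<=` cell c.
Proof.
by rewrite [X in _ `<=` X]cell_child; exact: bigcup_sup.
Qed.

Lemma integrable_cell_child c i f : int c f -> int (child c i) f.
Proof. by apply: integrableS => //; exact: sub_cell_child. Qed.

Lemma cell_avg_child c f : int c f ->
  av c f = (\sum_i av (child c i) f) / #|I|%:R.
Proof.
move=> fi; rewrite !cell_avgE.
have N0 : #|I|%:R != 0 :> R by rewrite pnatr_eq0 -lt0n.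
transitivity ((\sum_i \int[mu]_(x in cell (child c i)) f x) / vol c).
  have cE : cell c = \big[setU/set0]_i cell (child c i).
    have -> : cell c = \bigcup_(i in [set` index_enum I]) cell (child c i).
      rewrite cell_child; congr bigcup; apply/seteqP; split=> i //= _.
      exact: mem_index_enum.
    exact: bigcup_seq.
  congr (_ / _); rewrite /Rintegral {1}cE integral_bigsetU_EFin//.
  - rewrite -sum_fine// => i _; apply: integrable_fin_num => //.
    exact: integrable_cell_child.
  - exact: index_enum_uniq.
  - by move=> i j _ _; exact: trivIset_child.
  - by rewrite -cE; exact: (measurable_int mu).
rewrite !mulr_suml; apply: eq_bigr => i _.
by rewrite cell_avgE /vol (mu_child c i) invfM mulrA mulrAC.
Qed.

Lemma tree_cell_avg k c f : int c f -> tavg k (fun x => av x f) c = av c f.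
Proof.
apply: (@tree_avg_harmonic _ _ _ _ (fun x => int x f)) => [x i|x]; first exact: integrable_cell_child.
exact: cell_avg_child.
Qed.

Lemma integrable_le_cst c f b : measurable_fun (cell c) f ->
  (forall x, cell c x -> `|f x| <= b) -> int c f.
Proof.
move=> mf fb; apply: measurable_bounded_integrable => //.
by exists b; split; [exact: num_real|move=> y /ltW yb x /fb /le_trans; apply].
Qed.

Lemma integrable_cst c (a : R) : int c (fun=> a).
Proof. exact: (@integrable_le_cst _ _ `|a|). Qed.

Lemma integrable_addf c f g : int c f -> int c g -> int c (fun x => f x + g x).
Proof. by move=> fi gi; exact: (integrableD (measurable_cell c) fi gi). Qed.

Lemma integrable_subf c f g : int c f -> int c g -> int c (fun x => f x - g x).
Proof. by move=> fi gi; exact: (integrableB (measurable_cell c) fi gi). Qed.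

Lemma integrable_scalef c a f : int c f -> int c (fun x => a * f x).
Proof. by move=> fi; exact: (integrableZl (measurable_cell c) a fi). Qed.

Lemma integrable_normf c f : int c f -> int c (fun x => `|f x|).
Proof. exact: integrable_norm. Qed.

Lemma integrable_dist c f a : int c f -> int c (fun x => `|f x - a|).
Proof.
by move=> fi; apply/integrable_normf/integrable_subf => //; exact: integrable_cst.
Qed.

Lemma cell_avg_cst c a : av c (fun=> a) = a.
Proof. by rewrite !cell_avgE Rintegral_cst// -/(vol c) mulfK// gt_eqF. Qed.

Lemma cell_avgD c f g : int c f -> int c g ->
  av c (fun x => f x + g x) = av c f + av c g.
Proof. by move=> fi gi; rewrite !cell_avgE RintegralD// mulrDl. Qed.

Lemma cell_avgB c f g : int c f -> int c g ->
  av c (fun x => f x - g x) = av c f - av c g.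
Proof. by move=> fi gi; rewrite !cell_avgE RintegralB// mulrBl. Qed.

Lemma cell_avgZ c a f : int c f -> av c (fun x => a * f x) = a * av c f.
Proof. by move=> fi; rewrite !cell_avgE RintegralZl// mulrA. Qed.

Lemma cell_avg_le c f g : int c f -> int c g ->
  (forall x, cell c x -> f x <= g x) -> av c f <= av c g.
Proof.
by move=> fi gi fg; rewrite !cell_avgE ler_pM2r ?invr_gt0//; exact: le_Rintegral.
Qed.

Lemma cell_avg_ge0 c f : (forall x, cell c x -> 0 <= f x) -> 0 <= av c f.
Proof. by move=> f0; rewrite !cell_avgE divr_ge0 ?Rintegral_ge0// ltW. Qed.

Lemma norm_cell_avg c f : int c f -> `|av c f| <= av c (fun x => `|f x|).
Proof.
move=> fi; rewrite !cell_avgE normrM (ger0_norm (_ : 0 <= (vol c)^-1)); last first.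
  by rewrite invr_ge0 ltW.
by rewrite ler_pM2r ?invr_gt0//; exact: le_normr_Rintegral.
Qed.

Definition cell_osc f c : R := av c (fun x => `|f x - av c f|).

(** The mean is an optimal centre up to a factor 2, because its distance to [a] is at most the
    average of [|f - a|]. *)
Lemma cell_osc_le2 f c a : int c f -> cell_osc f c <= 2 * av c (fun x => `|f x - a|).
Proof.
move=> fi; have fa := integrable_dist a fi.
apply: (@le_trans _ _ (av c (fun x => `|f x - a| + `|av c f - a|))).
  apply: cell_avg_le; [exact: integrable_dist| |].
    by apply: integrable_addf => //; exact: integrable_cst.
  by move=> x _; rewrite (le_trans (ler_distD a _ _))// lerD2l distrC.
rewrite cell_avgD//; last exact: integrable_cst.
rewrite cell_avg_cst mulr2n mulrDl mul1r lerD2l.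
have -> : av c f - a = av c (fun x => f x - a).
  by rewrite cell_avgB ?cell_avg_cst//; exact: integrable_cst.
by apply: norm_cell_avg; apply: integrable_subf => //; exact: integrable_cst.
Qed.

Lemma cell_osc_approx f g c : int c f -> int c g ->
  cell_osc f c <= cell_osc g c + 2 * av c (fun x => `|f x - g x|).
Proof.
move=> fi gi.
have fg : int c (fun x => `|f x - g x|).
  by apply/integrable_normf/integrable_subf.
have -> : cell_osc g c + 2 * av c (fun x => `|f x - g x|) =
    av c (fun x => `|f x - g x| + (`|g x - av c g| + av c (fun x => `|f x - g x|))).
  rewrite cell_avgD//; last by apply: integrable_addf; [exact: integrable_dist|exact: integrable_cst].
  rewrite cell_avgD//; [|exact: integrable_dist|exact: integrable_cst].
  by rewrite cell_avg_cst /cell_osc; ring.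
apply: cell_avg_le; first exact: integrable_dist.
  apply: integrable_addf => //; apply: integrable_addf; first exact: integrable_dist.
  exact: integrable_cst.
move=> x _; rewrite (le_trans (ler_distD (g x) _ _))// lerD2l.
rewrite (le_trans (ler_distD (av c g) _ _))// lerD2l distrC -cell_avgB//.
by apply: norm_cell_avg; exact: integrable_subf.
Qed.

(* Equivalently, the averages of [f] over the descendants of [c] converge to [f]
   in L^1. *)
Definition vanishing_osc c f : Prop := int c f /\
  forall e, 0 < e -> exists K, forall k, (K <= k)%N -> tavg k (cell_osc f) c <= e.

(** The common limit argument for sums, multiples, Lipschitz images and products, which then need
    only an estimate cell by cell. *)
Lemma vanishing_osc_comb c f g1 g2 a b : 0 <= a -> 0 <= b ->
  vanishing_osc c g1 -> vanishing_osc c g2 -> int c f ->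
  (forall x, int x f -> int x g1 -> int x g2 ->
    cell_osc f x <= a * cell_osc g1 x + b * cell_osc g2 x) ->
  vanishing_osc c f.
Proof.
move=> a0 b0 [i1 v1] [i2 v2] fi fg; split; first exact: fi.
move=> e e0.
(* The added 1 covers a zero coefficient. *)
have small a' : 0 <= a' -> 0 < e / (2 * (a' + 1)) /\ a' * (e / (2 * (a' + 1))) <= e / 2.
  move=> a'0; have a1 : 0 < a' + 1 by rewrite ltr_wpDl.
  split; first by rewrite divr_gt0// mulr_gt0.
  have -> : e / 2 = (a' + 1) * (e / (2 * (a' + 1))) by field; rewrite gt_eqF.
  by rewrite ler_wpM2r ?lerDl// divr_ge0 ?ltW// mulr_gt0.
have [ea ea2] := small a a0; have [eb eb2] := small b b0.
have [K1 H1] := v1 _ ea; have [K2 H2] := v2 _ eb.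
exists (maxn K1 K2) => k; rewrite geq_max => /andP[/H1 h1 /H2 h2].
apply: (@le_trans _ _ (tavg k (fun x => a * cell_osc g1 x + b * cell_osc g2 x) c)).
  apply: (@tree_avg_le _ _ _ _ I0 (fun x => [/\ int x f, int x g1 & int x g2])).
  - by move=> x i [? ? ?]; split; exact: integrable_cell_child.
  - by move=> x [? ? ?]; exact: fg.
  - by split.
have -> : tavg k (fun x => a * cell_osc g1 x + b * cell_osc g2 x) c =
    a * tavg k (cell_osc g1) c + b * tavg k (cell_osc g2) c.
  by rewrite tree_avgD; congr (_ + _); exact: tree_avgZ.
rewrite [e]splitr; apply: lerD.
  by apply: le_trans ea2; rewrite ler_wpM2l.
by apply: le_trans eb2; rewrite ler_wpM2l.
Qed.

(** Replacing [f] by [g] costs, on average over any generation, twice their L^1 distance on the root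
    cell. This does not depend on the generation. *)
Lemma vanishing_osc_approx c f : int c f ->
  (forall e, 0 < e -> exists2 g, vanishing_osc c g & av c (fun x => `|f x - g x|) <= e) ->
  vanishing_osc c f.
Proof.
move=> fi H; split; first exact: fi.
move=> e e0.
have e4 : 0 < e / 4 by rewrite divr_gt0.
have e2 : 0 < e / 2 by rewrite divr_gt0.
have [g [gi v] ge] := H _ e4; have [K HK] := v _ e2.
exists K => k /HK hk.
apply: (@le_trans _ _ (tavg k (fun x => cell_osc g x +
    2 * av x (fun y => `|f y - g y|)) c)).
  apply: (@tree_avg_le _ _ _ _ I0 (fun x => int x f /\ int x g)) => //.
  - by move=> x i [? ?]; split; exact: integrable_cell_child.
  - by move=> x [? ?]; exact: cell_osc_approx.
rewrite tree_avgD tree_avgZ tree_cell_avg; first by lra.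
by apply/integrable_normf/integrable_subf.
Qed.

Lemma vanishing_osc_cst c a : vanishing_osc c (fun=> a).
Proof.
split; first exact: integrable_cst.
move=> e e0; exists 0%N => k _.
rewrite (_ : cell_osc _ = fun=> 0) ?tree_avg_cst ?ltW//.
apply/funext => x; transitivity (av x (fun=> 0)); last exact: cell_avg_cst.
by congr cell_avg; apply/funext => y; rewrite cell_avg_cst subrr normr0.
Qed.

Lemma cell_oscD c f g : int c f -> int c g ->
  cell_osc (fun x => f x + g x) c <= cell_osc f c + cell_osc g c.
Proof.
move=> fi gi; rewrite /cell_osc (cell_avgD fi gi).
rewrite -(cell_avgD (integrable_dist (av c f) fi) (integrable_dist (av c g) gi)).
apply: cell_avg_le; first by apply: integrable_dist; exact: integrable_addf.
  by apply: integrable_addf; exact: integrable_dist.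
by move=> x _; rewrite opprD addrACA ler_normD.
Qed.

Lemma cell_oscZ c a f : int c f -> cell_osc (fun x => a * f x) c = `|a| * cell_osc f c.
Proof.
move=> fi; rewrite /cell_osc (cell_avgZ a fi) -(cell_avgZ _ (integrable_dist (av c f) fi)).
by congr cell_avg; apply/funext => x; rewrite -mulrBr normrM.
Qed.

Lemma vanishing_oscD c f g : vanishing_osc c f -> vanishing_osc c g ->
  vanishing_osc c (fun x => f x + g x).
Proof.
move=> vf vg; apply: (vanishing_osc_comb ler01 ler01 vf vg).
  by apply: integrable_addf; [exact: vf.1|exact: vg.1].
move=> x _ fi gi; have H := cell_oscD fi gi.
by rewrite -(mul1r (cell_osc f x)) -(mul1r (cell_osc g x)) in H.
Qed.

Lemma vanishing_oscZ c a f : vanishing_osc c f -> vanishing_osc c (fun x => a * f x).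
Proof.
move=> vf; apply: (vanishing_osc_comb (normr_ge0 a) (lexx 0) vf vf).
  by apply: integrable_scalef; exact: vf.1.
by move=> x _ fi _; rewrite mul0r addr0 cell_oscZ.
Qed.

Lemma vanishing_osc_lipschitz c f (u : R -> R) (k : R) : 0 <= k ->
  (forall s t, `|u s - u t| <= k * `|s - t|) ->
  vanishing_osc c f -> int c (u \o f) -> vanishing_osc c (u \o f).
Proof.
move=> k0 Lu vf ui.
apply: (vanishing_osc_comb (_ : 0 <= 2 * k) (lexx 0) vf vf) => //.
  by rewrite mulr_ge0.
move=> x xi fi _; rewrite mul0r addr0.
apply: (le_trans (cell_osc_le2 (u (av x f)) xi)).
rewrite -mulrA ler_wpM2l// -(cell_avgZ _ (integrable_dist (av x f) fi)).
apply: cell_avg_le => [||y _]; [exact: integrable_dist| |exact: Lu].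
by apply: integrable_scalef; exact: integrable_dist.
Qed.

Lemma vanishing_oscM c f g : (forall x, `|f x| <= 1) -> (forall x, `|g x| <= 1) ->
  vanishing_osc c f -> vanishing_osc c g -> int c (fun x => f x * g x) ->
  vanishing_osc c (fun x => f x * g x).
Proof.
move=> f1 g1 vf vg fgi.
apply: (vanishing_osc_comb (_ : 0 <= 2) (_ : 0 <= 2) vf vg) => //.
move=> x xi fi gi.
apply: (le_trans (cell_osc_le2 (av x f * av x g) xi)).
rewrite -mulrDr ler_wpM2l//.
rewrite -(cell_avgD (integrable_dist (av x f) fi) (integrable_dist (av x g) gi)).
apply: cell_avg_le => [||y _]; first exact: integrable_dist.
  by apply: integrable_addf; exact: integrable_dist.
have -> : f y * g y - av x f * av x g = (f y - av x f) * g y + av x f * (g y - av x g).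
  by ring.
apply: (le_trans (ler_normD _ _)); rewrite (normrM (f y - _)) (normrM (av x f)) lerD//.
  by rewrite ler_piMr.
apply: ler_piMl => //; apply: (le_trans (norm_cell_avg fi)).
rewrite -[leRHS](cell_avg_cst x 1); apply: cell_avg_le => //.
- exact: integrable_normf.
- exact: integrable_cst.
Qed.

(** * The sets with vanishing oscillation are closed under complements and countable unions *)

Section density.
Variable c : C.

Definition vanishing_osc_set (A : set T) := measurable A /\ vanishing_osc c (\1_A : T -> R).

Let norm_indic_le1 (A : set T) x : `|\1_A x : R| <= 1.
Proof. by rewrite ger0_norm indicE; case: (_ \in _). Qed.

Let integrable_indicf (A : set T) : measurable A -> int c (\1_A : T -> R).
Proof.
by move=> mA; apply: (@integrable_le_cst _ _ 1) => // x _; exact: norm_indic_le1.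
Qed.

Lemma vanishing_osc_setC A : vanishing_osc_set A -> vanishing_osc_set (~` A).
Proof.
move=> [mA vA]; split; first exact: measurableC.
have := vanishing_oscD (vanishing_osc_cst c 1) (vanishing_oscZ (-1) vA).
congr vanishing_osc; apply/funext => x.
rewrite !indicE in_setC; case: (x \in A) => /=; ring.
Qed.

Lemma vanishing_osc_setI A B : vanishing_osc_set A -> vanishing_osc_set B -> vanishing_osc_set (A `&` B).
Proof.
move=> [mA vA] [mB vB]; have mAB := measurableI _ _ mA mB; split; first exact: mAB.
have := integrable_indicf mAB; rewrite indicI => iAB.
exact: vanishing_oscM.
Qed.

Lemma vanishing_osc_set_approx A : measurable A ->
  (forall e : R, 0 < e -> exists2 B, vanishing_osc_set B &
     (mu (cell c `&` (A `+` B)) <= e%:E)%E) -> vanishing_osc_set A.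
Proof.
move=> mA H; split; first exact: mA.
apply: vanishing_osc_approx; first exact: integrable_indicf.
move=> e e0; have [B [mB vB] AB] := H _ (mulr_gt0 e0 (vol_gt0 c)).
exists (\1_B) => //; rewrite cell_avgE ler_pdivrMr//.
have mAB : measurable (A `+` B) by apply: measurableU; exact: measurableD.
have -> : (fun x => `|\1_A x - \1_B x|) = \1_(A `+` B) :> (T -> R).
  apply/funext => x; rewrite !indicE.
  have -> : (x \in A `+` B) = (x \in A) (+) (x \in B).
    rewrite in_setU !in_setD.
    by case: (x \in A) (x \in B) => [] [].
  by case: (x \in A) (x \in B) => [] []; rewrite ?subrr ?subr0 ?sub0r ?normrN ?normr0 ?normr1.
rewrite /Rintegral integral_indic// setIC -lee_fin fineK//.
by rewrite ge0_fin_numE// (le_lt_trans AB)// ltry.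
Qed.


Lemma vanishing_osc_setU A B : vanishing_osc_set A -> vanishing_osc_set B -> vanishing_osc_set (A `|` B).
Proof.
by move=> sA sB; rewrite -(setCK (A `|` B)) setCU; do ?apply: vanishing_osc_setC;
  apply: vanishing_osc_setI; exact: vanishing_osc_setC.
Qed.

Lemma vanishing_osc_set0 : vanishing_osc_set set0.
Proof.
split; first exact: measurable0.
by rewrite indic0; exact: (vanishing_osc_cst c 0).
Qed.

(** The cell has finite measure, so by continuity from above the finite unions miss an arbitrarily
    small part of the union in it. *)
Lemma vanishing_osc_set_bigcup (F : (set T)^nat) : (forall k, vanishing_osc_set (F k)) ->
  vanishing_osc_set (\bigcup_k F k).
Proof.
move=> sF; pose U k := \big[setU/set0]_(i < k) F i.
have sU k : vanishing_osc_set (U k).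
  rewrite /U; elim/big_ind : _ => [|A B|i _]; [exact: vanishing_osc_set0|exact: vanishing_osc_setU|exact: sF].
have mU : measurable (\bigcup_k F k).
  by apply: bigcupT_measurable => k; exact: (sF k).1.
apply: vanishing_osc_set_approx => // e e0.
pose G k := cell c `&` (\bigcup_k F k `\` U k).
have mG k : measurable (G k).
  by apply: measurableI => //; apply: measurableD => //; exact: (sU k).1.
have G0 : \bigcap_k G k = set0.
  apply/seteqP; split=> x // Gx; have [_ [[k _ Fkx] _]] := Gx 0%N Logic.I.
  have [_ [_]] := Gx k.+1 Logic.I; apply; rewrite /U.
  exact: (@bigsetU_sup _ k).
have : mu (G k) @[k --> \oo] --> mu (\bigcap_k G k).
  apply: nonincreasing_cvg_mu => //.
  - by rewrite (le_lt_trans _ (mu_cell_fin c))// le_measure ?inE// => x [].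
  - by rewrite G0.
  - apply/nonincreasing_seqP => k; apply/subsetPset => x [cx [Fx nUx]].
    split=> //; split=> // Ux; apply: nUx; rewrite /U big_ord_recr/=.
    by left.
rewrite G0 measure0 => /fine_cvgP[Gfin].
move=> /cvgrPdist_le/(_ e e0)[K _ HK].
have [K' _ HK'] := Gfin.
pose k := maxn K K'.
exists (U k) => //.
have -> : \bigcup_k F k `+` U k = \bigcup_k F k `\` U k.
  rewrite /setY (_ : U k `\` _ = set0) ?setU0//.
  by apply/seteqP; split=> x // -[Ux]; apply; exact: bigsetU_bigcup Ux.
have := HK k (leq_maxl _ _); rewrite /= sub0r normrN ger0_norm ?fine_ge0//.
by rewrite -lee_fin fineK//; exact: (HK' k (leq_maxr _ _)).
Qed.

Hypothesis all_vanishing : forall A, measurable A -> vanishing_osc_set A.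

Import HBSimple.

Lemma vanishing_osc_sfun (g : {sfun T >-> R}) : vanishing_osc c g.
Proof.
have -> : (g : T -> R) = (fun x => \sum_(y \in range g) y * \1_(g @^-1` [set y]) x).
  by apply/funext => x; rewrite [LHS]fimfunE.
under eq_fun do rewrite fsbig_finite//=.
set s := fset_set _; elim: (_ s : seq R) => [|y t IH].
  by under eq_fun do rewrite big_nil; exact: vanishing_osc_cst.
under eq_fun do rewrite big_cons; apply: vanishing_oscD; last exact: IH.
by apply: vanishing_oscZ; exact: (all_vanishing _).2.
Qed.

Lemma vanishing_osc_integrable f : int c f -> vanishing_osc c f.
Proof.
move=> fi; apply: vanishing_osc_approx => // e e0.
have [g [gi _ gf]] := approximation_sfun_integrable (measurable_cell c) fi.
move/fine_cvgP : gf => [_ /cvgrPdist_le/(_ _ (mulr_gt0 e0 (vol_gt0 c)))[k _ Hk]].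
exists (g k); first exact: vanishing_osc_sfun.
have := Hk k (leqnn k); rewrite /= sub0r normrN ger0_norm ?fine_ge0 ?integral_ge0//.
by rewrite cell_avgE -ler_pdivrMr.
Qed.
End density.

(** Truncation keeps the averages finite while square integrability is unknown; monotone convergence
    removes it. *)
Lemma integral_sqr_le c f (B : R) : measurable_fun (cell c) f ->
  (forall k : nat, av c (fun x => Num.min `|f x| k%:R ^+ 2) <= B) ->
  (\int[mu]_(x in cell c) (`|f x| ^+ 2)%:E <= (B * fine (mu (cell c)))%:E)%E.
Proof.
move=> mf HB; pose g (k : nat) x := (Num.min `|f x| k%:R ^+ 2)%:E.
have mmin k : measurable_fun (cell c) (fun x => Num.min `|f x| k%:R ^+ 2).
  apply: measurable_funX; apply: measurable_minr => //.
  exact: measurableT_comp.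
have cvg_g x : g k x @[k --> \oo] --> (`|f x| ^+ 2)%:E.
  apply: cvg_near_cst; near=> k; congr (_ ^+ 2)%:E.
  by apply/min_idPl; near: k; exact: nbhs_infty_ger.
have mono : (\int[mu]_(x in cell c) g k x)%E @[k --> \oo] -->
    (\int[mu]_(x in cell c) (`|f x| ^+ 2)%:E)%E.
  have := @cvg_monotone_convergence _ _ _ mu _ (measurable_cell c) g.
  under [X in _ --> X]eq_integral do rewrite (cvg_lim _ (cvg_g _))//.
  apply=> [k|k x _|x _ k l kl]; first exact/measurable_EFinP.
    by rewrite lee_fin sqr_ge0.
  have kl' : k%:R <= l%:R :> R by rewrite ler_nat.
  rewrite lee_fin ler_sqr ?nnegrE ?le_min ?normr_ge0 ?ler0n//.
  by rewrite ge_min lexx ge_min kl' orbT.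
rewrite -(cvg_lim _ mono)//; apply: lime_le; first by apply/cvg_ex; eexists; exact: mono.
apply: nearW => k; have := HB k.
have gi : int c (fun x => Num.min `|f x| k%:R ^+ 2).
  apply: (@integrable_le_cst _ _ (k%:R ^+ 2)) => // x _.
  rewrite ger0_norm ?sqr_ge0// ler_sqr ?nnegrE ?le_min ?normr_ge0 ?ler0n//.
  by rewrite ge_min lexx orbT.
rewrite cell_avgE ler_pdivrMr// -lee_fin; apply: le_trans.
by rewrite /Rintegral fineK//; exact: integrable_fin_num.
Unshelve. all: by end_near. Qed.

(** * Oscillation measured by the gauge, and variances of the cell means *)

Section gauge_oscillation.
Variables (h : R -> R) (phi : T -> R) (P : C -> Prop).
Hypothesis gh : gauge h.
Hypothesis Pchild : forall c i, P c -> P (child c i).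
Hypothesis phi_int : forall c, P c -> int c phi.
Hypothesis phi_osc : forall c, P c -> vanishing_osc c phi.

Local Notation m := (fun c => av c phi).
Local Notation N := (#|I|%:R : R).

(** The tangent at 1 shows that [h] grows at most linearly. *)
Lemma integrable_gauge c a : P c -> int c (fun x => h `|phi x - a|).
Proof.
move=> Pc; have [M M0 HM] := gauge_tangent gh ltr01.
have fa := integrable_dist a (phi_int Pc).
have hM : int c (fun x => h 1 + M * (`|phi x - a| - 1)).
  apply: integrable_addf; first exact: integrable_cst.
  by apply/integrable_scalef/integrable_subf => //; exact: integrable_cst.
apply: (le_integrable (measurable_cell c) _ _ hM).
  have mh := continuous_measurable_fun (gauge_continuous gh).
  have mf : measurable_fun (cell c) (fun x => phi x - a).
    apply: measurable_funB => //; apply/measurable_EFinP.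
    exact: (measurable_int _ (phi_int Pc)).
  by apply/measurable_EFinP; exact: (measurableT_comp mh mf).
move=> x _ /=; rewrite lee_fin ger0_norm ?(gauge_ge0 gh)//.
by rewrite (le_trans _ (ler_norm _))// HM.
Qed.

(** Jensen's inequality with a fixed tangent: the bound is affine in the L^1 average, so it can be
    averaged again over a generation. *)
Lemma cell_avg_gauge_le c M (s : R) f : int c f -> int c (fun x => h `|f x|) ->
  (forall t, 0 <= t -> h t <= h s + M * (t - s)) ->
  av c (fun x => h `|f x|) <= h s + M * (av c (fun x => `|f x|) - s).
Proof.
move=> fi hi HM.
have -> : h s + M * (av c (fun x => `|f x|) - s) =
    av c (fun x => h s + M * (`|f x| - s)).
  rewrite cell_avgD; [|exact: integrable_cst|].
    rewrite cell_avgZ; last first.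
      by apply: integrable_subf; [exact: integrable_normf|exact: integrable_cst].
    rewrite cell_avgB; [|exact: integrable_normf|exact: integrable_cst].
    by rewrite !cell_avg_cst.
  apply/integrable_scalef/integrable_subf; last exact: integrable_cst.
  exact: integrable_normf.
apply: cell_avg_le => //; last by move=> x _; exact: HM.
apply: integrable_addf; first exact: integrable_cst.
apply/integrable_scalef/integrable_subf; last exact: integrable_cst.
exact: integrable_normf.
Qed.

(* [h \o sqrt] lies below its tangents, as
   [h t <= h s + M (t - s) <= h s + M (t^2 - s^2) / (2 s)]. *)
Lemma cell_avg_gauge_sqr c a s : P c -> 0 < s ->
  int c (fun x => `|phi x - a| ^+ 2) ->
  av c (fun x => `|phi x - a| ^+ 2) <= s ^+ 2 ->
  av c (fun x => h `|phi x - a|) <= h s.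
Proof.
move=> Pc s0 si avs; have [M M0 HM] := gauge_tangent gh s0.
have si' : int c (fun x => M / (2 * s) * (`|phi x - a| ^+ 2 - s ^+ 2)).
  by apply/integrable_scalef/integrable_subf => //; exact: integrable_cst.
apply: (@le_trans _ _ (av c (fun x => h s + M / (2 * s) * (`|phi x - a| ^+ 2 - s ^+ 2)))).
  apply: cell_avg_le; [exact: integrable_gauge| |].
    by apply: integrable_addf => //; exact: integrable_cst.
  move=> x _; move: (`|phi x - a|) (normr_ge0 (phi x - a)) => t t0.
  apply: (le_trans (HM t t0)); rewrite lerD2l -mulrA ler_wpM2l//.
  rewrite ler_pdivlMl ?mulr_gt0//.
  by have := sqr_ge0 (t - s); lra.
rewrite cell_avgD ?cell_avg_cst//; last exact: integrable_cst.
rewrite gerDl cell_avgZ; last by apply: integrable_subf => //; exact: integrable_cst.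
rewrite mulr_ge0_le0 ?divr_ge0 ?mulr_ge0 ?(ltW s0)//.
by rewrite cell_avgB ?cell_avg_cst ?subr_le0//; exact: integrable_cst.
Qed.

Lemma tree_avg_mean k c : P c -> tavg k m c = av c phi.
Proof. by move=> Pc; exact/tree_cell_avg/phi_int. Qed.

(** The last term is kept separate: [tree_var_bounded] bounds it by the same [K] as the first, while
    [min_sqr_gauge_le] makes it small by a large [k]. *)
Lemma gauge_mean_le k c : P c ->
  tavg k (fun x => h `|av x phi - av c phi|) c <=
  av c (fun x => h `|phi x - av c phi|) +
  tavg k (fun x => av x (fun y => h `|phi y - av x phi|)) c.
Proof.
move=> Pc; set a := av c phi.
rewrite -(tree_cell_avg k (integrable_gauge a Pc)) -(tree_avgD child k).
apply: (@tree_avg_le _ _ _ _ I0 P) => // x Px.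
have ha := integrable_gauge a Px; have hx := integrable_gauge (av x phi) Px.
rewrite -(cell_avgD ha hx) -[leLHS](cell_avg_cst x).
apply: cell_avg_le; [exact: integrable_cst|exact: integrable_addf|].
move=> y _; apply: le_trans (gauge_subadditive gh (normr_ge0 _) (normr_ge0 _)).
apply: (gauge_le gh) => //; rewrite (le_trans (ler_distD (phi y) _ _))//.
by rewrite addrC lerD2l distrC.
Qed.

(** The truncated square is [2 n]-Lipschitz, so replacing [phi] by its cell means costs an L^1
    oscillation, the only kind known to vanish. *)
Lemma min_sqr_mean_le k c (n B : R) : P c -> 0 <= n ->
  tree_var child k m c <= B ->
  av c (fun x => Num.min `|phi x - av c phi| n ^+ 2) <=
  B + 2 * n * tavg k (cell_osc phi) c.
Proof.
move=> Pc n0 VB; set a := av c phi.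
have min_int x : P x -> int x (fun x => Num.min `|phi x - a| n ^+ 2).
  move=> Px; apply: (@integrable_le_cst _ _ (n ^+ 2)).
    apply: measurable_funX; apply: measurable_minr => //.
    by apply/measurable_EFinP/(measurable_int mu)/integrable_dist/phi_int.
  move=> y _; rewrite ger0_norm ?sqr_ge0//.
  by rewrite ler_sqr ?nnegrE ?le_min ?normr_ge0 ?n0// ge_min lexx orbT.
rewrite -(tree_cell_avg k (min_int c Pc)).
apply: (@le_trans _ _ (tavg k (fun x => (av x phi - a) ^+ 2 + 2 * n * cell_osc phi x) c)).
  apply: (@tree_avg_le _ _ _ _ I0 P) => // x Px.
  have fi := integrable_dist (av x phi) (phi_int Px).
  rewrite /cell_osc -(cell_avgZ (2 * n) fi).
  rewrite -[X in X + _](cell_avg_cst x) -cell_avgD; [|exact: integrable_cst|exact: integrable_scalef].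
  apply: cell_avg_le; first exact: min_int.
    by apply: integrable_addf; [exact: integrable_cst|exact: integrable_scalef].
  move=> y _; set s := `|phi y - a|; set t := `|av x phi - a|.
  have st : s <= t + `|phi y - av x phi|.
    by rewrite addrC; exact: ler_distD.
  have s0 : 0 <= s by exact: normr_ge0.
  have t0 : 0 <= t by exact: normr_ge0.
  have d0 : 0 <= `|phi y - av x phi| by exact: normr_ge0.
  have -> : (av x phi - a) ^+ 2 = t ^+ 2 by rewrite /t real_normK ?num_real.
  move: (`|phi y - av x phi|) st d0 => r st r0.
  have [ts|st'] := leP s t.
    rewrite (@le_trans _ _ (t ^+ 2))// ?lerDl ?mulr_ge0//.
    by rewrite ler_sqr ?nnegrE ?le_min ?s0 ?n0// ge_min ts.
  set u := Num.min s n; have u0 : 0 <= u by rewrite le_min s0.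
  have us : u <= s by rewrite ge_min lexx.
  have un : u <= n by rewrite ge_min lexx orbT.
  have [ut|tu] := leP u t.
    by rewrite (@le_trans _ _ (t ^+ 2))// ?lerDl ?mulr_ge0// ler_sqr.
  clearbody u s t; rewrite -lerBlDl subr_sqr mulrC.
  by apply: ler_pM; [rewrite addr_ge0|rewrite subr_ge0 ltW|lra..].
rewrite tree_avgD (tree_avgZ child k (2 * n) (cell_osc phi)) lerD2r.
by rewrite (tree_avg_sqrB child I0) tree_avg_mean// subrr expr0n addr0.
Qed.

Lemma min_sqr_le c (n B : R) : P c -> 0 <= n ->
  (forall k, tree_var child k m c <= B) ->
  av c (fun x => Num.min `|phi x - av c phi| n ^+ 2) <= B.
Proof.
move=> Pc n0 VB; apply/ler_addgt0Pr => e e0.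
have e' : 0 < e / (2 * n + 1) by rewrite divr_gt0// ltr_wpDl// mulr_ge0.
have [K /(_ K (leqnn K)) HK] := (phi_osc Pc).2 _ e'.
apply: (le_trans (min_sqr_mean_le Pc n0 (VB K))); rewrite lerD2l.
apply: (@le_trans _ _ (2 * n * (e / (2 * n + 1)))).
  by rewrite ler_wpM2l// mulr_ge0.
have n1 : 0 < 2 * n + 1 by rewrite ltr_wpDl// mulr_ge0.
rewrite mulrA ler_pdivrMr// mulrC ler_wpM2l ?ltW//.
by rewrite ltrDl.
Qed.

(* Averaging [phi] over the cells of a generation at most doubles its
   [h]-oscillation, which bounds the variance of the averages uniformly. *)
Lemma tree_var_bounded (K D : R) : 0 < D -> 8 * N * K <= h D ->
  (forall c, P c -> av c (fun x => h `|phi x - av c phi|) <= K) ->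
  forall k c, P c -> tree_var child k m c <= D ^+ 2 / (4 * N).
Proof.
move=> D0 KD HK; have N0 : 0 < N by rewrite ltr0n.
have N40 : 0 < 4 * N by rewrite mulr_gt0.
elim/ltn_ind => k IH c Pc; rewrite leNgt; apply/negP => DV.
set V := tree_var child k m c in DV.
have V0 : 0 < V by rewrite (lt_trans _ DV)// divr_gt0// exprn_gt0.
(* If [V] is too large, it serves as [E] itself: the induction hypothesis puts all earlier variances
   below it. [D'] is the corresponding scale and exceeds [D]. *)
pose D' := Num.sqrt (4 * N * V).
have D'0 : 0 < D' by rewrite sqrtr_gt0 mulr_gt0.
have D'2 : D' ^+ 2 = 4 * N * V by rewrite sqr_sqrtr// mulr_ge0// ltW.
have DD' : D < D'.
  rewrite -ltr_sqr ?nnegrE ?ltW// D'2 mulrC -ltr_pdivrMr//.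
have := tree_var_gauge I0 gh Pchild D'0 (_ : 4 * N * V <= D' ^+ 2)
  (fun j x jk Px => le_trans (IH j jk x Px) (ltW DV)) Pc (lexx V).
rewrite D'2 lexx => /(_ isT).
rewrite leNgt => /negP; apply.
rewrite tree_avg_mean// (le_lt_trans (gauge_mean_le k Pc))//.
(* One [K] for the cell [c], one for the mean over its descendants; hence [8 N K] in the
   hypothesis. *)
apply: (@le_lt_trans _ _ (K + K)).
  rewrite lerD ?HK// -[leRHS](tree_avg_cst child I0 k K c).
  exact: (@tree_avg_le _ _ _ _ I0 P).
have -> : h D' / (4 * N * V) * V = h D' / (4 * N).
  by field; rewrite !gt_eqF.
rewrite ltr_pdivlMr//; apply: le_lt_trans (gauge_lt gh (ltW D0) DD').
by apply: le_trans KD; rewrite le_eqVlt; apply/orP; left; apply/eqP; ring.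
Qed.

Lemma min_sqr_gauge_le c (n K E D : R) : P c -> 0 <= n -> 0 < D ->
  4 * N * E <= D ^+ 2 ->
  (forall k c, P c -> tree_var child k m c <= E) ->
  av c (fun x => h `|phi x - av c phi|) <= K ->
  h D / D ^+ 2 * av c (fun x => Num.min `|phi x - av c phi| n ^+ 2) <= K.
Proof.
move=> Pc n0 D0 ED VE hK; apply/ler_addgt0Pr => e e0.
have e2 : 0 < e / 2 by rewrite divr_gt0.
(* With [h s = e / 2], the tangent at [s] bounds the [h]-distance from [phi] to its cell means by
   [e / 2] plus [M] times their L^1 distance. *)
have [s s0 hs] := gauge_onto gh (ltW e2).
have {}s0 : 0 < s.
  rewrite lt_def s0 andbT; apply: contraTneq e2 => s00.
  by rewrite -hs s00 (gauge0 gh) ltxx.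
have [M M0 HM] := gauge_tangent gh s0.
set kD := h D / D ^+ 2.
have kD0 : 0 <= kD by rewrite divr_ge0 ?exprn_ge0 ?(gauge_ge0 gh) ?(ltW D0).
(* The total coefficient of the L^1 oscillation: [M] from that tangent, [kD * (2 * n)] from the
   truncated square. *)
pose A := M + kD * (2 * n).
have A0 : 0 <= A.
  by apply: addr_ge0 => //; apply: mulr_ge0 => //; exact: mulr_ge0.
have A1 : 0 < A + 1 by exact: ltr_wpDl A0 ltr01.
have eA : 0 < e / 2 / (A + 1) by rewrite divr_gt0.
have [k /(_ k (leqnn k)) Hk] := (phi_osc Pc).2 _ eA.
have H1 := min_sqr_mean_le Pc n0 (lexx (tree_var child k m c)).
have H2 := tree_var_gauge I0 gh Pchild D0 ED (fun j x _ => VE j x) Pc (VE k c Pc).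
rewrite tree_avg_mean// -/kD in H2.
have H3 := gauge_mean_le k Pc.
have H4 : tavg k (fun x => av x (fun y => h `|phi y - av x phi|)) c <=
    e / 2 + M * tavg k (cell_osc phi) c.
  rewrite -(tree_avgZ child k M (cell_osc phi)) -[X in X + _](tree_avg_cst child I0 k (e / 2) c).
  rewrite -(tree_avgD child k); apply: (@tree_avg_le _ _ _ _ I0 P) => // x Px.
  have fi : int x (fun y => phi y - av x phi).
    by apply: integrable_subf; [exact: phi_int|exact: integrable_cst].
  apply: (le_trans (cell_avg_gauge_le fi (integrable_gauge _ Px) HM)).
  rewrite hs lerD2l ler_wpM2l// /cell_osc lerBlDr lerDl; exact: ltW.
have H5 : A * tavg k (cell_osc phi) c <= e / 2.
  apply: (@le_trans _ _ (A * (e / 2 / (A + 1)))); first by rewrite ler_wpM2l.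
  by rewrite mulrA ler_pdivrMr// mulrC ler_wpM2l ?ltW// ltrDl.
have := ler_wpM2l kD0 H1; rewrite mulrDr => H6.
move: H2 H3 H4 H5 H6 hK; rewrite /A; set o := tavg k (cell_osc phi) c.
set V := tree_var _ _ _ _; rewrite mulrDl -[kD * (2 * n) * o]mulrA.
lra.
Qed.

Lemma tree_var_le_avg k c : P c -> int c (fun x => `|phi x - av c phi| ^+ 2) ->
  tree_var child k m c <= av c (fun x => `|phi x - av c phi| ^+ 2).
Proof.
move=> Pc; set a := av c phi => si.
rewrite -(tree_cell_avg k si).
have <- : tavg k (fun x => (av x phi - a) ^+ 2) c = tree_var child k m c.
  by rewrite (tree_avg_sqrB child I0) tree_avg_mean// subrr expr0n addr0.
apply: (@tree_avg_le _ _ _ _ I0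
  (fun x => P x /\ int x (fun x => `|phi x - a| ^+ 2))) => //.
  by move=> x i [Px xi]; split; [exact: Pchild|exact: integrable_cell_child].
move=> x [Px xi]; set b := av x phi.
rewrite -[leLHS](cell_avg_cst x) -subr_ge0.
(* The added linear term has mean 0 on the cell and completes the square [(phi y - b) ^+ 2]. *)
have -> : av x (fun y => `|phi y - a| ^+ 2) - av x (fun=> (b - a) ^+ 2) =
    av x (fun y => `|phi y - a| ^+ 2 - (b - a) ^+ 2 - 2 * (b - a) * (phi y - b)).
  have pi : int x (fun y => phi y - b).
    by apply: integrable_subf; [exact: phi_int|exact: integrable_cst].
  rewrite [RHS]cell_avgB; [|by apply: integrable_subf => //; exact: integrable_cst|exact: integrable_scalef].
  rewrite (cell_avgZ _ pi) (cell_avgB (phi_int Px)); last exact: integrable_cst.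
  rewrite (cell_avg_cst x b) subrr mulr0 subr0 [RHS]cell_avgB//; exact: integrable_cst.
apply: cell_avg_ge0 => y _; rewrite real_normK ?num_real//.
have -> : (phi y - a) ^+ 2 - (b - a) ^+ 2 - 2 * (b - a) * (phi y - b) =
  (phi y - b) ^+ 2 by ring.
exact: sqr_ge0.
Qed.

End gauge_oscillation.
End cell_averages.

(** * Dyadic cubes *)

Section dyadic_cubes.
Context {R : realType} {n : nat}.

Local Notation BT := (n.-tuple (measurableTypeR R)).
Local Notation LT := (lebesgue_space R n).
Local Notation mu := (lebesgue R n).

Lemma measurable_lebesgue (A : set BT) :
  measurable A -> measurable (A : set LT).
Proof. exact: caratheodory_measurable_mu_ext. Qed.

Lemma lebesgueE (A : set BT) : measurable A ->
  mu A = borel_lebesgue n A.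
Proof. move=> mA; exact: (measurable_mu_extE (borel_lebesgue n) mA). Qed.

End dyadic_cubes.

(* Half-open cubes, unlike closed ones, are split exactly by dyadic division;
   the difference is a null set. *)
Definition hcube {R : realType} {n : nat} (a : n.-tuple R) (l : R) :
    set (n.-tuple R) :=
  [set x | forall i, tnth a i <= tnth x i < tnth a i + l].

Lemma measurable_hcube (R : realType) n (a : n.-tuple R) (l : R) :
  @measurable _ (n.-tuple (measurableTypeR R)) (hcube a l).
Proof.
have -> : hcube a l = \bigcap_(i in [set: 'I_n])
    ((fun x : n.-tuple (measurableTypeR R) => tnth x i) @^-1`
       `[tnth a i, tnth a i + l[%classic).
  apply/seteqP; split => [x ax i _ /=|x ax i].
    by rewrite in_itv/=; exact: ax.
  by have /= := ax i Logic.I; rewrite in_itv.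
apply: fin_bigcap_measurable => // i _.
rewrite -[X in measurable X]setTI.
by apply: measurable_tnth => //; exact: measurable_itv.
Qed.

Lemma borel_lebesgue_hcube (R : realType) n (a : n.-tuple R) (l : R) :
  0 < l -> borel_lebesgue n (hcube a l) = (l ^+ n)%:E.
Proof.
move=> l0; elim: n a => [|n IH] a.
  by rewrite /= diracE mem_set ?expr0// => -[].
have tla i : tnth a (lift ord0 i) = tnth [tuple of behead a] i.
  by rewrite {1}(tuple_eta a) tnthS.
rewrite /= /lebesgue_step /pushforward.
have -> : @cons_pt R n @^-1` hcube a l =
    `[thead a, thead a + l[%classic `*` hcube [tuple of behead a] l.
  apply/seteqP; split => -[x t] /=.
    move=> axt; split; first by rewrite in_itv/=; exact: (axt ord0).
    by move=> i; have := axt (lift ord0 i); rewrite tla tnthS.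
  rewrite in_itv/= => -[ax bt] i.
  case: (unliftP ord0 i) => [j|] ->; last exact: ax.
  by have := bt j; rewrite tla tnthS.
rewrite product_measure1E//=; last exact: measurable_hcube.
by rewrite IH lebesgue_measure_itv/= lte_fin ltrDl l0 -EFinD addrAC subrr add0r -EFinM exprS.
Qed.

Section half_open_cubes.
Context {R : realType} {n : nat}.
Local Notation BT := (n.-tuple (measurableTypeR R)).
Local Notation LT := (lebesgue_space R n).
Local Notation mu := (lebesgue R n).
Implicit Types (a : n.-tuple R) (l : R).

Let mcube a l : measurable (cube a l : set LT).
Proof. exact: (measurable_lebesgue (measurable_cube a l)). Qed.

Let mhcube a l : measurable (hcube a l : set LT).
Proof. exact: (measurable_lebesgue (measurable_hcube a l)). Qed.

Lemma lebesgue_hcube a l : 0 < l -> mu (hcube a l) = (l ^+ n)%:E.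
Proof.
by move=> l0; rewrite lebesgueE ?borel_lebesgue_hcube//; exact: measurable_hcube.
Qed.

Lemma hcube_sub_cube a l : hcube a l `<=` cube a l.
Proof. by move=> x ax i; have /andP[-> /ltW] := ax i. Qed.

Lemma lebesgue_cubeD a l : 0 < l -> mu (cube a l `\` hcube a l) = 0%E.
Proof.
move=> l0.
have mc := mcube a l; have mh := mhcube a l.
have cE := lebesgue_cube a (ltW l0).
have cfin : (mu (cube a l) < +oo)%E by rewrite cE ltry.
transitivity (mu (cube a l) - mu (cube a l `&` hcube a l))%E.
  exact: (measureD mc mh cfin).
rewrite (_ : cube a l `&` hcube a l = hcube a l); last exact/setIidPr/hcube_sub_cube.
by rewrite cE lebesgue_hcube// subee.
Qed.

Lemma integral_cube a l (f : LT -> \bar R) : 0 < l -> measurable_fun (cube a l : set LT) f ->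
  (forall x, 0 <= f x)%E ->
  (\int[mu]_(x in cube a l) f x = \int[mu]_(x in hcube a l) f x)%E.
Proof.
move=> l0 mf f0.
have mc := mcube a l; have mh := mhcube a l.
have mN : measurable (cube a l `\` hcube a l : set LT) by exact: measurableD.
rewrite (ge0_negligible_integral mN mc mf)//; last exact: lebesgue_cubeD.
congr integral; rewrite setDD; exact/setIidPr/hcube_sub_cube.
Qed.

Lemma integrable_hcube a l (f : LT -> \bar R) :
  mu.-integrable (cube a l) f -> mu.-integrable (hcube a l) f.
Proof.
apply: integrableS; last exact: hcube_sub_cube.
- exact: (measurable_lebesgue (measurable_cube a l)).
- exact: (measurable_lebesgue (measurable_hcube a l)).
Qed.

Lemma integral_cube_integrable a l (f : LT -> \bar R) : 0 < l ->
  mu.-integrable (cube a l) f ->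
  (\int[mu]_(x in cube a l) f x = \int[mu]_(x in hcube a l) f x)%E.
Proof.
move=> l0 fi.
have mc := mcube a l; have mh := mhcube a l.
have mN : measurable (cube a l `\` hcube a l : set LT) by exact: measurableD.
rewrite (negligible_integral mN mc fi)//; last exact: lebesgue_cubeD.
congr integral; rewrite setDD; exact/setIidPr/hcube_sub_cube.
Qed.

(** Positivity of the side is part of the type, so the tree axioms hold at every node. *)
Definition dyadic_node := (n.-tuple R * {posnum R})%type.
Definition dyadic_index : finType := {ffun 'I_n -> bool}.

Definition dyadic_cube (c : dyadic_node) : set LT := hcube c.1 c.2%:num.

Definition dyadic_child (c : dyadic_node) (v : dyadic_index) : dyadic_node :=
  ([tuple tnth c.1 i + (v i)%:R * (c.2%:num / 2) | i < n], (c.2%:num / 2)%:pos).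

Lemma dyadic_index_card : #|dyadic_index| = (2 ^ n)%N.
Proof. by rewrite card_ffun card_bool card_ord. Qed.

Lemma dyadic_index_gt0 : (0 < #|dyadic_index|)%N.
Proof. by rewrite dyadic_index_card expn_gt0. Qed.

Lemma measurable_dyadic_cube c : measurable (dyadic_cube c).
Proof. exact: (measurable_lebesgue (measurable_hcube _ _)). Qed.

Lemma lebesgue_dyadic_cube c : mu (dyadic_cube c) = (c.2%:num ^+ n)%:E.
Proof. exact: lebesgue_hcube. Qed.

Lemma lebesgue_dyadic_cube_lty c : (mu (dyadic_cube c) < +oo)%E.
Proof. by rewrite lebesgue_dyadic_cube ltry. Qed.

Lemma lebesgue_dyadic_cube_gt0 c : (0 < mu (dyadic_cube c))%E.
Proof. by rewrite lebesgue_dyadic_cube lte_fin exprn_gt0. Qed.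

Lemma lebesgue_dyadic_child c v :
  fine (mu (dyadic_cube c)) = #|dyadic_index|%:R * fine (mu (dyadic_cube (dyadic_child c v))).
Proof.
rewrite !lebesgue_dyadic_cube/= dyadic_index_card natrX -exprMn; congr (_ ^+ _).
by rewrite mulrC divfK.
Qed.

Let half_itvP (b : bool) (a l t : R) : 0 < l ->
  (a + b%:R * (l / 2) <= t < a + b%:R * (l / 2) + l / 2) <->
  (a <= t < a + l) /\ b = (a + l / 2 <= t).
Proof.
move=> l0; have {l0} : 0 < l / 2 by rewrite divr_gt0.
rewrite (_ : a + l = a + (l / 2 + l / 2)); last by rewrite -splitr.
move: (l / 2) => q q0.
case: b; rewrite /= ?mulr1n ?mulr0n ?mul1r ?mul0r; split.
- move=> /andP[H1 H2]; rewrite H1; split=> //; apply/andP; split; lra.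
- by move=> [/andP[H1 H2] /esym H3]; apply/andP; split=> //; lra.
- move=> /andP[H1 H2]; split; first by apply/andP; split; lra.
  by apply/esym/negbTE; rewrite -ltNge; lra.
- move=> [/andP[H1 H2] /esym/negbT]; rewrite -ltNge => H3.
  by apply/andP; split; lra.
Qed.

(** A point of the cube determines the bits of the child that contains it; covering and disjointness
    both follow. *)
Lemma dyadic_childP c v x : dyadic_cube (dyadic_child c v) x <-> dyadic_cube c x /\
  forall i, v i = (tnth c.1 i + c.2%:num / 2 <= tnth (x : n.-tuple R) i).
Proof.
have l0 : 0 < c.2%:num :> R by [].
rewrite /dyadic_cube /hcube /=; split=> [H|[H E] i].
  by split=> i; have := H i; rewrite tnth_mktuple => /(half_itvP _ _ _ l0)[].
by rewrite tnth_mktuple; apply/(half_itvP _ _ _ l0); split; [exact: H|exact: E].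
Qed.

Lemma dyadic_cube_child c : dyadic_cube c = \bigcup_v dyadic_cube (dyadic_child c v).
Proof.
apply/seteqP; split=> [x cx|x [v _ /dyadic_childP[]//]].
exists [ffun i => tnth c.1 i + c.2%:num / 2 <= tnth (x : n.-tuple R) i] => //.
by apply/dyadic_childP; split=> // i; rewrite ffunE.
Qed.

Lemma trivIset_dyadic_child c : trivIset setT (fun v => dyadic_cube (dyadic_child c v)).
Proof.
move=> u v _ _ [x [/dyadic_childP[_ ux] /dyadic_childP[_ vx]]].
by apply/ffunP => i; rewrite ux vx.
Qed.

End half_open_cubes.

(** * Dyadic averages converge in mean *)

Section dyadic_density.
Context {R : realType} {n : nat}.
Local Notation BT := (n.-tuple (measurableTypeR R)).
Local Notation LT := (lebesgue_space R n).
Local Notation mu := (lebesgue R n).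
Local Notation dyadic_node := (@dyadic_node R n).

Lemma dyadic_cube_tree : cell_tree mu (@dyadic_child R n) (@dyadic_cube R n).
Proof.
split.
- exact: dyadic_index_gt0.
- exact: measurable_dyadic_cube.
- exact: lebesgue_dyadic_cube_lty.
- exact: lebesgue_dyadic_cube_gt0.
- exact: dyadic_cube_child.
- exact: trivIset_dyadic_child.
- exact: lebesgue_dyadic_child.
Qed.

Local Notation vanishing :=
  (vanishing_osc (mu := mu) (child := @dyadic_child R n) (cell := @dyadic_cube R n)).
Local Notation vanishing_set :=
  (vanishing_osc_set (mu := mu) (child := @dyadic_child R n) (cell := @dyadic_cube R n)).

Lemma measurable_coord (i : 'I_n) :
  measurable_fun setT (fun x : LT => tnth (x : n.-tuple R) i : measurableTypeR R).
Proof.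
move=> _ Y mY; rewrite setTI.
apply: (@measurable_lebesgue R n); rewrite -[X in measurable X]setTI.
by apply: (@measurable_tnth _ (measurableTypeR R) n i) => //.
Qed.

Lemma coord_bound (c : dyadic_node) (i : 'I_n) (x : LT) : dyadic_cube c x ->
  `|tnth (x : n.-tuple R) i - tnth c.1 i| <= c.2%:num.
Proof.
move=> /(_ i)/andP[H1 H2]; rewrite ger0_norm ?subr_ge0//.
by rewrite lerBlDl ltW.
Qed.

Lemma integrable_coord (c : dyadic_node) (i : 'I_n) :
  mu.-integrable (dyadic_cube c) (EFin \o (fun x : LT => tnth (x : n.-tuple R) i)).
Proof.
apply: (integrable_le_cst dyadic_cube_tree (b := `|tnth c.1 i| + c.2%:num)).
  exact: measurable_funTS (measurable_coord i).
move=> x cx; rewrite -[tnth _ i](subrK (tnth c.1 i)) addrC.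
by rewrite (le_trans (ler_normD _ _))// lerD2l; exact: coord_bound.
Qed.

(** On a cube a coordinate stays within one side length of that of the corner, and the side halves
    in each generation. *)
Lemma vanishing_coord (c : dyadic_node) (i : 'I_n) :
  vanishing c (fun x : LT => tnth (x : n.-tuple R) i).
Proof.
split; first exact: integrable_coord.
move=> e e0.
have c2 : 0 < 2 * c.2%:num by rewrite mulr_gt0.
pose K := (Num.bound (2 * c.2%:num / e)).
exists K => k Kk.
apply: (@le_trans _ _ (tree_avg (@dyadic_child R n) k (fun x => 2 * x.2%:num) c)).
  apply: (@tree_avg_le _ _ _ _ dyadic_index_gt0 (fun=> True)) => // x _.
  apply: (le_trans (cell_osc_le2 dyadic_cube_tree (tnth x.1 i) (integrable_coord x i))).
  rewrite ler_wpM2l// -[leRHS](cell_avg_cst dyadic_cube_tree x).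
  apply: (cell_avg_le dyadic_cube_tree); last by move=> y; exact: coord_bound.
    exact: (integrable_dist dyadic_cube_tree _ (integrable_coord x i)).
  exact: (integrable_cst dyadic_cube_tree).
rewrite tree_avgZ (@tree_avg_geometric _ _ _ _ dyadic_index_gt0 _ 2^-1) => [|x v]; last first.
  by rewrite mulrC.
rewrite mulrCA exprVn ler_pdivrMl ?exprn_gt0// -ler_pdivrMr//.
apply: (@le_trans _ _ K%:R).
  by rewrite ltW// archi_boundP// divr_ge0 // ltW.
rewrite -natrX ler_nat (leq_trans Kk)//.
by rewrite ltnW// ltn_expl.
Qed.

(** The projection onto [[0, 1]], written with absolute values so that its Lipschitz bound and
    measurability come from theirs. *)
Let clamp (t : R) : R := (`|t| - `|t - 1| + 1) / 2.

Let clamp_lipschitz s t : `|clamp s - clamp t| <= 1 * `|s - t|.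
Proof.
have -> : clamp s - clamp t = ((`|s| - `|t|) - (`|s - 1| - `|t - 1|)) / 2.
  by rewrite /clamp; field.
rewrite mul1r normrM (gtr0_norm (_ : 0 < 2^-1)) ?invr_gt0// ler_pdivrMr//.
rewrite mulr2n mulrDr mulr1 (le_trans (ler_normB _ _))// lerD//.
  exact: ler_dist_dist.
rewrite (le_trans (ler_dist_dist _ _))//.
by rewrite opprB addrA subrK.
Qed.

Let clamp1 t : 1 <= t -> clamp t = 1.
Proof.
move=> t1; have t0 : 0 <= t by apply: le_trans t1.
by rewrite /clamp !ger0_norm ?subr_ge0//; field.
Qed.

Let clamp0 t : t <= 0 -> clamp t = 0.
Proof.
move=> t0; rewrite /clamp !ler0_norm//; first by field.
by rewrite subr_le0 (le_trans t0).
Qed.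

Let norm_clamp t : `|clamp t| <= 1.
Proof.
have [t0|t0] := leP t 0; first by rewrite clamp0// normr0 ler01.
have [t1|t1] := leP 1 t; first by rewrite clamp1// normr1.
rewrite /clamp (ger0_norm (ltW t0)) (ler0_norm (_ : t - 1 <= 0)); last first.
  by rewrite subr_le0 ltW.
by rewrite ger0_norm; lra.
Qed.

Let measurable_ramp (k r : R) :
  measurable_fun setT (fun t : R => clamp (1 + k * (t - r))).
Proof.
have mz : measurable_fun setT (fun t : R => 1 + k * (t - r)).
  apply: measurable_funD; first exact: measurable_cst.
  apply: measurable_funM; first exact: measurable_cst.
  by apply: measurable_funB; [exact: measurable_id|exact: measurable_cst].
have mn := @normr_measurable R setT.
apply: measurable_funM; last exact: measurable_cst.
apply: measurable_funD; last exact: measurable_cst.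
apply: measurable_funB; first exact: (measurableT_comp mn mz).
apply: (measurableT_comp mn).
by apply: measurable_funB; [exact: mz|exact: measurable_cst].
Qed.

Lemma vanishing_osc_halfspace (c : dyadic_node) (i : 'I_n) (r : R) :
  vanishing_set c [set x : LT | r <= tnth (x : n.-tuple R) i].
Proof.
set A := (X in vanishing_set c X).
have mA : measurable A.
  have := measurable_coord i measurableT (measurable_itv (Interval (BLeft r) (BInfty R false))).
  rewrite setTI; congr measurable; apply/seteqP; split => x /=;
  by rewrite in_itv/= andbT.
split=> //.
(* A ramp equal to 1 from [r] on and, for [k > 0], to 0 before [r - 1 / k]: at each point, also on
   the hyperplane, it is eventually the indicator of the closed half-space. *)
pose g (k : nat) (x : LT) : R := clamp (1 + k%:R * (tnth (x : n.-tuple R) i - r)).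
have mg k : measurable_fun setT (g k).
  exact: (measurableT_comp (measurable_ramp k%:R r) (measurable_coord i)).
have gi k : mu.-integrable (dyadic_cube c) (EFin \o g k).
  apply: (integrable_le_cst dyadic_cube_tree (b := 1)).
    exact: measurable_funTS.
  by move=> x _; exact: norm_clamp.
have Ai : mu.-integrable (dyadic_cube c) (EFin \o (\1_A : LT -> R)).
  apply: (integrable_le_cst dyadic_cube_tree (b := 1)) => //.
  by move=> x _; rewrite ger0_norm indicE; case: (_ \in _).
have gv k : vanishing c (g k).
  apply: (@vanishing_osc_lipschitz _ _ _ _ _ _ _ _ dyadic_cube_tree c _
    (fun t => clamp (1 + k%:R * (t - r))) k%:R (ler0n _ _) _ (vanishing_coord c i)).
    move=> s t; rewrite (le_trans (clamp_lipschitz _ _))// mul1r.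
    have -> : 1 + k%:R * (s - r) - (1 + k%:R * (t - r)) = k%:R * (s - t) by ring.
    by rewrite normrM normr_nat.
  exact: gi.
apply: (vanishing_osc_approx dyadic_cube_tree Ai) => e e0.
have gA x : (g k x)%:E @[k --> \oo] --> (\1_A x : R)%:E.
  apply: cvg_near_cst; rewrite indicE.
  have [xA|/negP xA] := boolP (r <= tnth (x : n.-tuple R) i).
    apply: nearW => k; rewrite mem_set// /g clamp1//.
    by rewrite lerDl mulr_ge0 ?subr_ge0.
  rewrite memNset//; move/negP: xA; rewrite -ltNge => xr.
  near=> k; rewrite /g clamp0//.
  have d0 : 0 < r - tnth (x : n.-tuple R) i by rewrite subr_gt0.
  have : (r - tnth (x : n.-tuple R) i)^-1 <= k%:R by near: k; exact: nbhs_infty_ger.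
  by rewrite -div1r ler_pdivrMr// -opprB mulrN; lra.
have dom : {ae mu, forall x k, dyadic_cube c x -> (`|(g k x)%:E| <= 1)%E}.
  apply: aeW => x k _; rewrite lee_fin.
  exact: norm_clamp.
have [_ + _] := dominated_convergence (measurable_dyadic_cube c)
  (fun k => measurable_int _ (gi k)) (measurable_int _ Ai)
  (aeW _ (fun x _ => gA x)) (integrable_cst dyadic_cube_tree c 1) dom.
have vol0 : 0 < fine (mu (dyadic_cube c)) by rewrite lebesgue_dyadic_cube/= exprn_gt0.
move=> /fine_cvgP[_ /cvgrPdist_le/(_ _ (mulr_gt0 e0 vol0))[k _ Hk]].
exists (g k); first exact: gv.
have := Hk k (leqnn k); rewrite /= sub0r normrN ger0_norm ?fine_ge0 ?integral_ge0//.
move=> H; rewrite cell_avgE ler_pdivrMr; last exact: vol0.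
apply: le_trans H; rewrite /Rintegral le_eqVlt; apply/orP; left; apply/eqP.
by congr fine; apply: eq_integral => x _; rewrite /= distrC.
Unshelve. all: by end_near. Qed.

(** Two generation arguments: half-lines generate the Borel sets of the line, and preimages of these
    under the coordinates generate the product sigma-algebra. *)
Let vanishing_osc_borel (c : dyadic_node) (A : set BT) : measurable A -> vanishing_set c (A : set LT).
Proof.
have half i : <<s @RGenCInfty.G R >> `<=`
    [set B | vanishing_set c [set x : LT | B (tnth (x : n.-tuple R) i)]].
  apply: smallest_sub => [|_ [r ->]].
    split=> /=.
    - exact: vanishing_osc_set0 dyadic_cube_tree c.
    - by move=> B sB; have := vanishing_osc_setC dyadic_cube_tree sB; rewrite -setTD.
    - by move=> F sF; exact: (vanishing_osc_set_bigcup dyadic_cube_tree sF).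
  have := vanishing_osc_halfspace c i r; congr vanishing_osc_set.
  by apply/seteqP; split=> x /=; rewrite in_itv/= andbT.
move: A; apply: smallest_sub.
  split.
  - exact: vanishing_osc_set0 dyadic_cube_tree c.
  - by move=> B sB; rewrite setTD; exact: (vanishing_osc_setC dyadic_cube_tree sB).
  - by move=> F sF; exact: (vanishing_osc_set_bigcup dyadic_cube_tree sF).
move=> A; rewrite -bigcup_seq => -[i _ [B mB <-]]; rewrite setTI.
apply: half; suff : (@RGenCInfty.G R).-sigma.-measurable B by [].
by rewrite -RGenCInfty.measurableE.
Qed.

(** The Lebesgue measure is an infimum over countable Borel covers, so the part of [A] in the cube
    has a Borel superset of nearly the same measure. *)
Lemma vanishing_osc_measurable (c : dyadic_node) (A : set LT) : measurable A -> vanishing_set c A.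
Proof.
move=> mA; apply: (vanishing_osc_set_approx dyadic_cube_tree mA) => e e0.
(* [A] may have infinite measure; its part in the cube does not. *)
pose A' := A `&` dyadic_cube c.
have mA' : measurable A' by apply: measurableI => //; exact: measurable_dyadic_cube.
have A'fin : mu A' \is a fin_num.
  rewrite ge0_fin_numE// (le_lt_trans _ (lebesgue_dyadic_cube_lty c))//.
  by rewrite le_measure ?inE//; [exact: measurable_dyadic_cube|exact: subIsetr].
have [_ [F [mF AF] <-] HF] := lb_ereal_inf_adherent e0 A'fin.
pose B := \bigcup_k F k.
have mB : measurable (B : set BT) by exact: bigcupT_measurable.
exists B; first exact: vanishing_osc_borel.
have BF : (mu B <= \sum_(k <oo) borel_lebesgue n (F k))%E.
  by apply: ereal_inf_lbound; exists F => //; split.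
have mB' : measurable (B : set LT) by exact: measurable_lebesgue.
have Bfin : (mu B < +oo)%E.
  by rewrite (le_lt_trans (le_trans BF (ltW HF)))// lte_add_pinfty ?ltry// ltey_eq A'fin.
apply: (@le_trans _ _ (mu (B `\` A'))).
  apply: le_measure; rewrite ?inE.
  - by apply: measurableI; [exact: measurable_dyadic_cube|apply: measurableU; exact: measurableD].
  - exact: measurableD.
  - move=> x [cx [[Ax nBx]|[Bx nAx]]]; first by exfalso; apply/nBx/AF.
    by split=> // -[].
have -> : mu (B `\` A') = (mu B - mu (B `&` A'))%E by exact: (measureD mB' mA' Bfin).
rewrite (_ : B `&` A' = A'); last exact/setIidPr.
rewrite leeBlDl//; exact: (le_trans BF (ltW HF)).
Qed.

Lemma vanishing_osc_dyadic (c : dyadic_node) (f : LT -> R) :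
  mu.-integrable (dyadic_cube c) (EFin \o f) -> vanishing c f.
Proof. exact: (vanishing_osc_integrable dyadic_cube_tree (vanishing_osc_measurable c)). Qed.

End dyadic_density.

(** * Averages over cubes *)

Section cube_averages.
Context {R : realType} {n : nat}.
Local Notation LT := (lebesgue_space R n).
Local Notation mu := (lebesgue R n).
Local Notation dyadic_node := (@dyadic_node R n).
Local Notation av := (cell_avg (mu := mu) (cell := @dyadic_cube R n)).
Implicit Types (c : dyadic_node) (f : LT -> R).

Definition closure_cube c : set (n.-tuple R) := cube c.1 c.2%:num.

Lemma measurable_closure_cube c : measurable (closure_cube c : set LT).
Proof. exact: (measurable_lebesgue (measurable_cube _ _)). Qed.

Lemma mean_cell_avg c f : mu.-integrable (closure_cube c) (EFin \o f) ->
  mean (closure_cube c) f = av c f.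
Proof.
move=> fi; rewrite /mean /avg cell_avgE /closure_cube.
rewrite (integral_cube_integrable _ fi)//.
have di := integrable_hcube fi.
rewrite lebesgue_cube// lebesgue_dyadic_cube/= inver gt_eqF ?exprn_gt0//.
by rewrite fineM//; exact: (integrable_fin_num (measurable_dyadic_cube c) di).
Qed.

Lemma avg_ge0E c f : measurable_fun (closure_cube c : set LT) f ->
  (forall x, 0 <= f x) ->
  (avg (closure_cube c) f =
   \int[mu]_(x in dyadic_cube c) (f x)%:E * ((c.2%:num ^+ n)^-1)%:E)%E.
Proof.
move=> mf f0; have c0 : 0 < c.2%:num by [].
have mf' : measurable_fun (cube c.1 c.2%:num : set LT) (EFin \o f).
  exact/measurable_EFinP.
have f0' x : (0 <= (EFin \o f) x)%E by rewrite lee_fin.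
rewrite /avg /closure_cube (integral_cube c0 mf' f0').
by rewrite (lebesgue_cube _ (ltW c0)) inver gt_eqF// exprn_gt0.
Qed.

Lemma avg_cell_avg c f : measurable_fun (closure_cube c : set LT) f ->
  (forall x, 0 <= f x) -> mu.-integrable (dyadic_cube c) (EFin \o f) ->
  avg (closure_cube c) f = (av c f)%:E.
Proof.
move=> mf f0 fi; rewrite avg_ge0E// cell_avgE lebesgue_dyadic_cube/= EFinM /Rintegral fineK//.
exact: (integrable_fin_num (measurable_dyadic_cube c) fi).
Qed.

Lemma avg_le_integral c f (B : R) : measurable_fun (closure_cube c : set LT) f ->
  (forall x, 0 <= f x) ->
  (avg (closure_cube c) f <= B%:E)%E =
  (\int[mu]_(x in dyadic_cube c) (f x)%:E <= (B * fine (mu (dyadic_cube c)))%:E)%E.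
Proof.
move=> mf f0; rewrite avg_ge0E// lebesgue_dyadic_cube/=.
by rewrite lee_pdivrMr ?exprn_gt0// EFinM.
Qed.

Lemma closure_child_sub c v : closure_cube (dyadic_child c v) `<=` closure_cube c.
Proof.
move=> x /= H i; have := H i; rewrite tnth_mktuple/=.
have c0 : 0 < c.2%:num / 2 :> R by [].
have -> : tnth c.1 i + c.2%:num = tnth c.1 i + (c.2%:num / 2 + c.2%:num / 2).
  by rewrite -splitr.
move: (c.2%:num / 2) c0 => q q0.
by case: (v i); rewrite /= ?mulr1n ?mulr0n ?mul1r ?mul0r => /andP[H1 H2];
  apply/andP; split; lra.
Qed.

End cube_averages.

(** * Finiteness of the norm and the two inequalities *)

Section main.
Context {R : realType} {n : nat} (h : R -> R).
Hypothesis gh : gauge h.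
Variables (Q : set (n.-tuple R)) (phi : n.-tuple R -> R).
Hypothesis Q_cube : is_cube Q.
Hypothesis phi_L1 : L1 Q phi.
Hypothesis K_fin : (K_ h Q phi < +oo)%E.

Local Notation LT := (lebesgue_space R n).
Local Notation mu := (lebesgue R n).
Local Notation dyadic_node := (@dyadic_node R n).
Local Notation av := (cell_avg (mu := mu) (cell := @dyadic_cube R n)).
Local Notation N := (#|@dyadic_index n|%:R : R).

Let P (c : dyadic_node) := closure_cube c `<=` Q.

Let Pchild c v : P c -> P (dyadic_child c v).
Proof. by move=> Pc; apply: subset_trans Pc; exact: closure_child_sub. Qed.

(** Every subcube of [Q], dyadic in [Q] or not, is the root of its own tree. *)
Let subcubesP J : subcubes Q J <-> exists2 c : dyadic_node, P c & J = closure_cube c.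
Proof.
split=> [[[a [l [l0 ->]]] JQ]|[c Pc ->]]; first by exists (a, PosNum l0).
by split=> //; exists c.1, c.2%:num.
Qed.

Let Q_cell : exists2 c : dyadic_node, P c & Q = closure_cube c.
Proof. by apply/subcubesP; split. Qed.

Let measurable_Q : measurable (Q : set LT).
Proof. by have [c _ ->] := Q_cell; exact: measurable_closure_cube. Qed.

Let phi_cube (c : dyadic_node) : P c -> mu.-integrable (closure_cube c) (EFin \o phi).
Proof.
by move=> Pc; exact: (integrableS measurable_Q (measurable_closure_cube c) Pc phi_L1).
Qed.

Let phi_int (c : dyadic_node) : P c -> mu.-integrable (dyadic_cube c) (EFin \o phi).
Proof. by move=> /phi_cube; exact: integrable_hcube. Qed.

Let phi_osc (c : dyadic_node) : P c ->
  vanishing_osc (mu := mu) (child := @dyadic_child R n) (cell := @dyadic_cube R n) c phi.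
Proof. by move=> /phi_int; exact: vanishing_osc_dyadic. Qed.

Let mean_phi (c : dyadic_node) : P c -> mean (closure_cube c) phi = av c phi.
Proof. by move=> /phi_cube; exact: mean_cell_avg. Qed.

Let measurable_dist (c : dyadic_node) a : P c ->
  measurable_fun (closure_cube c : set LT) (fun x : LT => phi x - a).
Proof.
move=> Pc; apply: measurable_funB; last exact: measurable_cst.
by apply/measurable_EFinP; exact: (measurable_int mu (phi_cube Pc)).
Qed.

Let measurable_sqr (c : dyadic_node) a : P c ->
  measurable_fun (closure_cube c : set LT) (fun x : LT => `|phi x - a| ^+ 2).
Proof.
move=> Pc; apply: measurable_funX.
exact: (measurableT_comp (@normr_measurable R setT) (measurable_dist a Pc)).
Qed.

Let avg_gauge (c : dyadic_node) : P c ->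
  avg (closure_cube c) (fun x => h `|phi x - mean (closure_cube c) phi|) =
  (av c (fun x => h `|phi x - av c phi|))%:E.
Proof.
move=> Pc; rewrite mean_phi//; apply: avg_cell_avg.
- have mh := continuous_measurable_fun (gauge_continuous gh).
  exact: (measurableT_comp mh (measurable_dist (av c phi) Pc)).
- by move=> x; exact: (gauge_ge0 gh).
- exact: (integrable_gauge dyadic_cube_tree gh phi_int).
Qed.

Let k := fine (K_ h Q phi).

Let K_E : K_ h Q phi = k%:E.
Proof.
rewrite /k fineK// ge0_fin_numE//.
have [c Pc _] := Q_cell; apply: le_trans (ereal_sup_ubound _); last first.
  by exists (closure_cube c) => //; apply/subcubesP; exists c.
rewrite avg_gauge// lee_fin; apply: cell_avg_ge0 => [|x _]; first exact: dyadic_cube_tree.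
exact: (gauge_ge0 gh).
Qed.

Let k_ge0 : 0 <= k.
Proof.
have [c Pc _] := Q_cell; rewrite -lee_fin -K_E.
apply: le_trans (ereal_sup_ubound _); last first.
  by exists (closure_cube c) => //; apply/subcubesP; exists c.
rewrite avg_gauge// lee_fin; apply: cell_avg_ge0 => [|x _]; first exact: dyadic_cube_tree.
exact: (gauge_ge0 gh).
Qed.

Let gauge_le_k (c : dyadic_node) : P c -> av c (fun x => h `|phi x - av c phi|) <= k.
Proof.
move=> Pc; rewrite -lee_fin -avg_gauge// -K_E; apply: ereal_sup_ubound.
by exists (closure_cube c) => //; apply/subcubesP; exists c.
Qed.

Let sqr_avg (c : dyadic_node) :=
  avg (closure_cube c) (fun x => `|phi x - mean (closure_cube c) phi| ^+ 2).

Let sqr_avg_le (c : dyadic_node) (B : R) : P c ->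
  (forall j : nat, av c (fun x => Num.min `|phi x - av c phi| j%:R ^+ 2) <= B) ->
  (sqr_avg c <= B%:E)%E.
Proof.
move=> Pc HB; rewrite /sqr_avg mean_phi// avg_le_integral.
- apply: (integral_sqr_le dyadic_cube_tree) HB.
  apply: measurable_funS (measurable_dist (av c phi) Pc).
    exact: measurable_closure_cube.
  exact: hcube_sub_cube.
- exact: measurable_sqr.
- by move=> x; exact: sqr_ge0.
Qed.

Let sqr_avg_ge0 c : (0 <= sqr_avg c)%E.
Proof.
rewrite /sqr_avg /avg mule_ge0//; first by apply: integral_ge0 => x _; rewrite lee_fin sqr_ge0.
by rewrite lebesgue_cube// inver gt_eqF ?exprn_gt0// lee_fin invr_ge0 exprn_ge0.
Qed.

Let sqrte_le (x : \bar R) (B : R) : 0 <= B ->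
  (sqrte x <= B%:E)%E = (x <= (B ^+ 2)%:E)%E.
Proof.
move=> B0; rewrite -[in RHS]lee_sqrt ?lee_fin ?sqr_ge0//=.
by rewrite sqrtr_sqr ger0_norm.
Qed.

Let BMO_norm_le (B : R) : 0 <= B ->
  (forall c, P c -> (sqr_avg c <= (B ^+ 2)%:E)%E) -> (BMO_norm Q phi <= B%:E)%E.
Proof.
move=> B0 HB; apply: ge_ereal_sup => _ [J /subcubesP[c Pc ->] <-].
by rewrite sqrte_le//; exact: HB.
Qed.

Let BMO_norm_ge0 : (0 <= BMO_norm Q phi)%E.
Proof.
have [c Pc _] := Q_cell; apply: le_trans (ereal_sup_ubound _); last first.
  by exists (closure_cube c) => //; apply/subcubesP; exists c.
exact: sqrte_ge0.
Qed.

Let N0 : 0 < N.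
Proof. by rewrite ltr0n dyadic_index_gt0. Qed.

Let BMO_norm_lty : (BMO_norm Q phi < +oo)%E.
Proof.
(* The added 1 makes [D] positive even when [k = 0]. *)
have y0 : 0 < 8 * N * k + 1 by rewrite ltr_wpDl// !mulr_ge0.
have [D D_ge0 hD] := gauge_onto gh (ltW y0).
have D0 : 0 < D.
  by rewrite lt_def D_ge0 andbT; apply: contraTneq y0 => D0; rewrite -hD D0 (gauge0 gh) ltxx.
have KD : 8 * N * k <= h D by rewrite hD lerDl.
pose B := D ^+ 2 / (4 * N).
have B0 : 0 <= B by rewrite divr_ge0 ?sqr_ge0// mulr_ge0.
apply: (@le_lt_trans _ _ (Num.sqrt B)%:E); last exact: ltry.
apply: BMO_norm_le; first exact: sqrtr_ge0.
move=> c Pc; rewrite sqr_sqrtr//; apply: sqr_avg_le => // j.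
apply: (min_sqr_le dyadic_cube_tree Pchild phi_int phi_osc) => // i.
exact: (tree_var_bounded dyadic_cube_tree gh Pchild phi_int D0 KD gauge_le_k).
Qed.

Let s := fine (BMO_norm Q phi).

Let s_E : BMO_norm Q phi = s%:E.
Proof. by rewrite /s fineK// ge0_fin_numE. Qed.

Let s_ge0 : 0 <= s.
Proof. by rewrite -lee_fin -s_E. Qed.

Let sqr_avg_s c : P c -> (sqr_avg c <= (s ^+ 2)%:E)%E.
Proof.
move=> Pc; rewrite -sqrte_le// -s_E; apply: ereal_sup_ubound.
by exists (closure_cube c) => //; apply/subcubesP; exists c.
Qed.

Let integrable_sqr c : P c ->
  mu.-integrable (dyadic_cube c) (EFin \o (fun x : LT => `|phi x - av c phi| ^+ 2)).
Proof.
move=> Pc; apply/integrableP; split.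
  apply/measurable_EFinP; apply: measurable_funS (measurable_sqr (av c phi) Pc).
    exact: measurable_closure_cube.
  exact: hcube_sub_cube.
have := sqr_avg_s Pc; rewrite /sqr_avg mean_phi// avg_le_integral.
- move=> H; apply: (@le_lt_trans _ _ (s ^+ 2 * fine (mu (dyadic_cube c)))%:E); last exact: ltry.
  apply: le_trans H; rewrite le_eqVlt; apply/orP; left; apply/eqP.
  by apply: eq_integral => x _; rewrite /= ger0_norm ?sqr_ge0.
- exact: measurable_sqr.
- by move=> x; exact: sqr_ge0.
Qed.

Let av_sqr c : P c -> av c (fun x => `|phi x - av c phi| ^+ 2) <= s ^+ 2.
Proof.
move=> Pc; rewrite -lee_fin -avg_cell_avg.
- by have := sqr_avg_s Pc; rewrite /sqr_avg mean_phi.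
- exact: measurable_sqr.
- by move=> x; exact: sqr_ge0.
- exact: integrable_sqr.
Qed.

Let k_le_gauge (t : R) : 0 < t -> s <= t -> k <= h t.
Proof.
move=> t0 st; rewrite -lee_fin -K_E; apply: ge_ereal_sup => _ [J /subcubesP[c Pc ->] <-].
rewrite avg_gauge// lee_fin.
apply: (cell_avg_gauge_sqr dyadic_cube_tree gh phi_int) => //; first exact: integrable_sqr.
by apply: (le_trans (av_sqr Pc)); rewrite ler_sqr ?nnegrE// ltW.
Qed.

(** All variances are at most [s ^+ 2], so every mean square oscillation is at most
    [k * D ^+ 2 / h D], and so is their supremum [s ^+ 2]. Since [s] is finite and positive,
    [s ^+ 2] cancels against [D ^+ 2 = 4 N s ^+ 2]. *)
Let gauge_le_k_s (D : R) : 0 < s -> 0 < D -> 4 * N * s ^+ 2 = D ^+ 2 ->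
  h D <= 4 * N * k.
Proof.
move=> s0 D0 ED.
have hD0 : 0 < h D by rewrite -(gauge0 gh); exact: (gauge_lt gh).
have D20 : 0 < D ^+ 2 by rewrite exprn_gt0.
have tv j c : P c -> tree_var (@dyadic_child R n) j (fun c => av c phi) c <= s ^+ 2.
  move=> Pc; apply: le_trans (av_sqr Pc).
  exact: (tree_var_le_avg dyadic_cube_tree Pchild phi_int _ Pc (integrable_sqr Pc)).
pose B := k / (h D / D ^+ 2).
have B0 : 0 <= B by rewrite divr_ge0// divr_ge0 ?ltW.
have sB : s <= Num.sqrt B.
  rewrite -lee_fin -s_E; apply: BMO_norm_le; first exact: sqrtr_ge0.
  move=> c Pc; rewrite sqr_sqrtr//; apply: sqr_avg_le => // j.
  rewrite ler_pdivlMr ?divr_gt0// mulrC.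
  apply: (min_sqr_gauge_le dyadic_cube_tree gh Pchild phi_int phi_osc Pc _ D0 (E := s ^+ 2)) => //.
    by rewrite ED.
  exact: gauge_le_k.
have : s ^+ 2 <= B by rewrite -(sqr_sqrtr B0) ler_sqr ?nnegrE// sqrtr_ge0.
rewrite ler_pdivlMr ?divr_gt0// mulrA ler_pdivrMr// -ED => H.
have s20 : 0 < s ^+ 2 by rewrite exprn_gt0.
by rewrite -(ler_pM2l s20) (le_trans H)// le_eqVlt; apply/orP; left; apply/eqP; ring.
Qed.

Lemma BMO_gauge_equiv : BMO Q phi /\
  ((inv_on_nonneg h (fine (K_ h Q phi)))%:E <= BMO_norm Q phi <=
   (2 `^ (- (n%:R / 2) - 1) *
    inv_on_nonneg h (2 ^+ (n + 2) * fine (K_ h Q phi)))%:E)%E.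
Proof.
split; first by split.
rewrite -/k s_E !lee_fin; apply/andP; split.
  have [t t0 ht] := gauge_onto gh k_ge0.
  rewrite -ht inv_on_nonnegK// leNgt; apply/negP => st.
  (* [k_le_gauge] needs a positive argument and [s] may be 0; the midpoint is positive and still
     below [t]. *)
  have [st1 st2] : s <= (s + t) / 2 /\ (s + t) / 2 < t.
    by move: (s) st => r rt; split; lra.
  have st0 : 0 < (s + t) / 2 by rewrite divr_gt0// ltr_wpDl// (le_lt_trans s_ge0).
  have := k_le_gauge st0 st1; rewrite -ht leNgt => /negP; apply.
  exact: (gauge_lt gh (ltW st0)).
have y0 : 0 <= 2 ^+ (n + 2) * k by rewrite mulr_ge0// exprn_ge0.
have [t t0 ht] := gauge_onto gh y0.
rewrite -ht inv_on_nonnegK//.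
have p0 : 0 < 2 `^ (- (n%:R / 2) - 1) :> R by rewrite powR_gt0.
have [s0|s0] := leP s 0; first by rewrite (le_trans s0)// mulr_ge0// ltW.
(* This is [2 sqrt N * s]; the claim becomes [D <= t], which follows from [h D <= h t]. *)
pose D := (2 `^ (- (n%:R / 2) - 1))^-1 * s.
have D0 : 0 < D by rewrite mulr_gt0// invr_gt0.
have N2 : 4 * N = 2 ^+ (n + 2) 
  by rewrite dyadic_index_card natrX exprD mulrC expr2 -natrM.
have ED : 4 * N * s ^+ 2 = D ^+ 2.
  rewrite exprMn; congr (_ * _); rewrite N2 -powRN opprD opprK opprK.
  rewrite -[RHS]powR_mulrn ?powR_ge0// -powRrM -[LHS]powR_mulrn//; congr (_ `^ _).
  by rewrite natrD; field.
have hDt : h D <= h t by rewrite ht -N2; exact: gauge_le_k_s.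
rewrite -ler_pdivrMl//.
rewrite leNgt; apply/negP => tD.
by have := gauge_lt gh t0 tD; rewrite ltNge hDt.
Qed.

End main.

Unset Implicit Arguments.
Set Strict Implicit.

Theorem theorem1p1 (R : realType) (h : R -> R)
  (h_cont : {within `[0, +oo[%classic, continuous h})
  (h_diff1 : forall t : R, 0 < t -> derivable h t 1)
  (h_diff2 : forall t : R, 0 < t -> derivable h^`() t 1)
  (h_diff3 : forall t : R, 0 < t -> derivable h^`(2) t 1)
  (h_0 : h 0 = 0)
  (h_infty : h t @[t --> +oo] --> +oo)
  (h_d1 : forall t : R, 0 < t -> 0 < h^`() t)
  (h_d2 : forall t : R, 0 < t -> h^`(2) t < 0)
  (h_d3 : forall t : R, 0 < t -> 0 < h^`(3) t)
  (n : nat) (n_gt0 : (0 < n)%N)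
  (Q : set (n.-tuple R)) (Q_cube : is_cube Q)
  (phi : n.-tuple R -> R) (phi_L1 : L1 Q phi)
  (K_fin : (K_ h Q phi < +oo)%E) :
  BMO Q phi /\
  ((inv_on_nonneg h (fine (K_ h Q phi)))%:E <= BMO_norm Q phi <=
   (2 `^ (- (n%:R / 2) - 1) *
    inv_on_nonneg h (2 ^+ (n + 2) * fine (K_ h Q phi)))%:E)%E.
Proof.
apply: BMO_gauge_equiv => //; exact: gauge_of_derivatives.
Qed.
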